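(* Let $n,d,s\ge1$, $\underline{i}=(i_1,\dots,i_s)\in\{1,\dots,d\}^s$ and $\underline{\alpha}=(\alpha_1,\dots,\alpha_s)\in\{1,\dots,n\}^s$. Then for $\mu$-almost every $\omega\in\Omega$, $$\lim_{m\to\infty}\tau_{\varepsilon_m}\Big(\tilde{x}_{i_1}^{\alpha_1}(m)(\omega)\cdots\tilde{x}_{i_s}^{\alpha_s}(m)(\omega)\Big)=\tau\big(x_{i_1}^{\alpha_1}\cdots x_{i_s}^{\alpha_s}\big).$$
   Context: Free product side: $\mathcal{C}(\mathbb{R}^d)$ is the complex unital $*$-algebra generated by self-adjoint $x_1,\dots,x_d$ with $x_ix_j+x_jx_i=2\delta_{ij}\mathbf 1$, with the tracial state vanishing on all products $x_{j_1}\cdots x_{j_r}$, $j_1<\cdots<j_r$, $r\ge1$. For $1\le\alpha\le n$, $\mathcal{M}_\alpha$ is a copy of $\mathcal{C}(\mathbb{R}^d)$ with generators $x_1^\alpha,\dots,x_d^\alpha$, and $\mathcal{M}=\mathcal{M}_1*\cdots*\mathcal{M}_n$ is the reduced free product von Neumann algebra with its free product trace $\tau$. Random spin model: let $[N]=\{1,\dots,N\}$, $\Upsilon=[n]\times[d]\times\mathbb{Z}_+$ (third index $\geq 1$), $\Upsilon_m=[n]\times[d]\times[m]$, with lexicographic order. On a probability space $(\Omega,\mu)$ let $\varepsilon((\alpha,i,k),(\beta,j,\ell))\in\{-1,1\}$, for $(\alpha,i,k)<(\beta,j,\ell)$ in $\Upsilon$, be independent random variables with $\mu(\varepsilon((\alpha,i,k),(\beta,j,\ell))=-1)$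 equal to $1$ if $\alpha=\beta$ and to $1/2$ if $\alpha\ne\beta$; extend $\varepsilon$ symmetrically with value $-1$ on the diagonal, and let $\varepsilon_m$ be its restriction to $\Upsilon_m\times\Upsilon_m$. For each $\omega$, $\mathcal{A}_{\varepsilon_m}$ is the complex unital $*$-algebra generated by self-adjoint $x_i^\alpha(k)$, $(\alpha,i,k)\in\Upsilon_m$, with relations $$x_i^\alpha(k)x_j^\beta(\ell)-\varepsilon((\alpha,i,k),(\beta,j,\ell))x_j^\beta(\ell)x_i^\alpha(k)=2\delta_{(\alpha,i,k),(\beta,j,\ell)}\mathbf 1.$$ For $A\subset\Upsilon_m$ let $x_A^{\varepsilon_m}$ be the product of the generators indexed by $A$ in increasing order ($x_\emptyset^{\varepsilon_m}=\mathbf 1$); these form a linear basis, and $\tau_{\varepsilon_m}$ is the tracial state with $\tau_{\varepsilon_m}(x_A^{\varepsilon_m})=\delta_{A,\emptyset}$. Finally $\tilde{x}_i^\alpha(m)=\frac1{\sqrt m}\sum_{k=1}^m x_i^\alpha(k)$ (depending on $\omega$). *)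

(* Defs.v *)
From HB Require Import structures.
From mathcomp Require Import all_boot all_order all_algebra.
From mathcomp Require Import generic_quotient complex ring.
From mathcomp Require Import all_classical all_reals all_analysis.
Set Implicit Arguments.
Unset Strict Implicit.
Unset Printing Implicit Defensive.
Import Order.TTheory GRing.Theory Num.Theory.
Import numFieldNormedType.Exports.
Local Open Scope classical_set_scope.
Local Open Scope ring_scope.
Local Open Scope complex_scope.
Local Open Scope quotient_scope.

(* The diagonal value -1 makes the relation below read x_p^2 = 1. *)
Record signfun (R : realType) (I : Type) := SignFun {
  signfun_val :> I -> I -> R ;
  signfunP : forall p q, signfun_val p q = 1 \/ signfun_val p q = -1 ;
  signfunC : forall p q, signfun_val p q = signfun_val q p ;
  signfun_diag : forall p, signfun_val p p = -1 }.

Definition signfun_comp (R : realType) (I J : Type) (h : J -> I)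
    (e : signfun R I) : signfun R J :=
  @SignFun R J (fun p q => e (h p) (h q)) (fun p q => signfunP e (h p) (h q))
    (fun p q => signfunC e (h p) (h q)) (fun p => signfun_diag e (h p)).

Definition clifford_sign (R : realType) (I : Type) : signfun R I :=
  @SignFun R I (fun _ _ => -1) (fun _ _ => or_intror erefl) (fun _ _ => erefl)
    (fun _ => erefl).

Inductive sterm (R : realType) (I : Type) : Type :=
| SGen of I
| SCst of R[i]
| SAdd of sterm R I & sterm R I
| SMul of sterm R I & sterm R I
| SAdj of sterm R I.
Arguments SGen {R I}.
Arguments SCst {R I}.

(* The complex unital *-algebra with self-adjoint generators x_p and relations
   x_p x_q - e(p,q) x_q x_p = 2 delta_{p,q} is the quotient of the terms by the
   congruence generated by the axioms of complex unital *-algebras, the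
   self-adjointness of the generators and these relations. *)
Inductive spin_rel (R : realType) (I : eqType) (e : signfun R I) :
    sterm R I -> sterm R I -> Prop :=
| srel_refl a : spin_rel e a a
| srel_sym a b : spin_rel e a b -> spin_rel e b a
| srel_trans a b c : spin_rel e a b -> spin_rel e b c -> spin_rel e a c
| srel_add a a' b b' : spin_rel e a a' -> spin_rel e b b' ->
    spin_rel e (SAdd a b) (SAdd a' b')
| srel_mul a a' b b' : spin_rel e a a' -> spin_rel e b b' ->
    spin_rel e (SMul a b) (SMul a' b')
| srel_adj a a' : spin_rel e a a' -> spin_rel e (SAdj a) (SAdj a')
| srel_addA a b c : spin_rel e (SAdd a (SAdd b c)) (SAdd (SAdd a b) c)
| srel_addC a b : spin_rel e (SAdd a b) (SAdd b a)
| srel_add0 a : spin_rel e (SAdd (SCst 0) a) a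
| srel_addN a : spin_rel e (SAdd (SMul (SCst (-1)) a) a) (SCst 0)
| srel_mulA a b c : spin_rel e (SMul a (SMul b c)) (SMul (SMul a b) c)
| srel_mul1l a : spin_rel e (SMul (SCst 1) a) a
| srel_mul1r a : spin_rel e (SMul a (SCst 1)) a
| srel_mulDl a b c : spin_rel e (SMul (SAdd a b) c) (SAdd (SMul a c) (SMul b c))
| srel_mulDr a b c : spin_rel e (SMul a (SAdd b c)) (SAdd (SMul a b) (SMul a c))
| srel_cstD x y : spin_rel e (SCst (x + y)) (SAdd (SCst x) (SCst y))
| srel_cstM x y : spin_rel e (SCst (x * y)) (SMul (SCst x) (SCst y))
| srel_cstC x a : spin_rel e (SMul (SCst x) a) (SMul a (SCst x))
| srel_adj_cst x : spin_rel e (SAdj (SCst x)) (SCst (Num.conj x))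
| srel_adjD a b : spin_rel e (SAdj (SAdd a b)) (SAdd (SAdj a) (SAdj b))
| srel_adjM a b : spin_rel e (SAdj (SMul a b)) (SMul (SAdj b) (SAdj a))
| srel_adjK a : spin_rel e (SAdj (SAdj a)) a
| srel_adj_gen p : spin_rel e (SAdj (SGen p)) (SGen p)
| srel_comm p q : spin_rel e
    (SAdd (SMul (SGen p) (SGen q))
          (SMul (SCst (- (e p q)%:C)) (SMul (SGen q) (SGen p))))
    (SCst (2 * (p == q)%:R)).

HB.instance Definition _ (R : realType) (I : Type) := gen_eqMixin (sterm R I).
HB.instance Definition _ (R : realType) (I : Type) := gen_choiceMixin (sterm R I).

Section SpinAlg.
Context {R : realType} {disp : Order.disp_t} {I : finOrderType disp} (e : signfun R I).

Definition spin_eqv (a b : sterm R I) : bool := `[< spin_rel e a b >].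

Lemma spin_eqv_equiv : equiv_class_of spin_eqv.
Proof.
split=> [a|a b|b a c].
- exact/asboolP/srel_refl.
- by apply/asboolP/asboolP => /srel_sym.
- by move=> /asboolP ab /asboolP bc; apply/asboolP/(srel_trans ab bc).
Qed.

Canonical spin_equivRel := EquivRelPack spin_eqv_equiv.

Definition spin_alg : Type := {eq_quot spin_equivRel}.
HB.instance Definition _ := Choice.on spin_alg.

Definition spin_class (a : sterm R I) : spin_alg := \pi_{eq_quot spin_equivRel} a.
Definition spin_repr (u : spin_alg) : sterm R I := repr u.

Lemma spin_classP a b : (spin_class a = spin_class b) <-> spin_rel e a b.
Proof.
split=> [/eqP|ab]; first by rewrite /spin_class eqmodE => /asboolP.
by apply/eqP; rewrite /spin_class eqmodE; apply/asboolP.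
Qed.

Lemma spin_reprK u : spin_class (spin_repr u) = u.
Proof. exact: reprK. Qed.

Lemma spin_repr_class a : spin_rel e (spin_repr (spin_class a)) a.
Proof. by apply/spin_classP; rewrite spin_reprK. Qed.

Lemma spin_ind (Q : spin_alg -> Prop) : (forall a, Q (spin_class a)) -> forall u, Q u.
Proof. by move=> H u; rewrite -(spin_reprK u). Qed.

Definition spin_add u v := spin_class (SAdd (spin_repr u) (spin_repr v)).
Definition spin_mul u v := spin_class (SMul (spin_repr u) (spin_repr v)).
Definition spin_scale (x : R[i]) u := spin_class (SMul (SCst x) (spin_repr u)).
Definition spin_cst x : spin_alg := spin_class (SCst x).
Definition spin_adj u := spin_class (SAdj (spin_repr u)).

Lemma spin_addE a b : spin_add (spin_class a) (spin_class b) = spin_class (SAdd a b).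
Proof. by apply/spin_classP/srel_add; exact: spin_repr_class. Qed.
Lemma spin_mulE a b : spin_mul (spin_class a) (spin_class b) = spin_class (SMul a b).
Proof. by apply/spin_classP/srel_mul; exact: spin_repr_class. Qed.
Lemma spin_scaleE x a : spin_scale x (spin_class a) = spin_class (SMul (SCst x) a).
Proof. by apply/spin_classP/srel_mul; [exact: srel_refl|exact: spin_repr_class]. Qed.
Lemma spin_adjE a : spin_adj (spin_class a) = spin_class (SAdj a).
Proof. by apply/spin_classP/srel_adj; exact: spin_repr_class. Qed.

Lemma spin_addrA : associative spin_add.
Proof.
elim/spin_ind=> a; elim/spin_ind=> b; elim/spin_ind=> c.
by rewrite !spin_addE; apply/spin_classP/srel_addA.
Qed.
Lemma spin_addrC : commutative spin_add.
Proof.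
by elim/spin_ind=> a; elim/spin_ind=> b; rewrite !spin_addE; apply/spin_classP/srel_addC.
Qed.
Lemma spin_add0r : left_id (spin_cst 0) spin_add.
Proof. by elim/spin_ind=> a; rewrite spin_addE; apply/spin_classP/srel_add0. Qed.
Lemma spin_addNr : left_inverse (spin_cst 0) (spin_scale (-1)) spin_add.
Proof.
by elim/spin_ind=> a; rewrite spin_scaleE spin_addE; apply/spin_classP/srel_addN.
Qed.
HB.instance Definition _ := GRing.isZmodule.Build spin_alg
  spin_addrA spin_addrC spin_add0r spin_addNr.

Lemma spin_mulrA : associative spin_mul.
Proof.
elim/spin_ind=> a; elim/spin_ind=> b; elim/spin_ind=> c.
by rewrite !spin_mulE; apply/spin_classP/srel_mulA.
Qed.
Lemma spin_mul1r : left_id (spin_cst 1) spin_mul.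
Proof. by elim/spin_ind=> a; rewrite spin_mulE; apply/spin_classP/srel_mul1l. Qed.
Lemma spin_mulr1 : right_id (spin_cst 1) spin_mul.
Proof. by elim/spin_ind=> a; rewrite spin_mulE; apply/spin_classP/srel_mul1r. Qed.
Lemma spin_mulrDl : left_distributive spin_mul spin_add.
Proof.
elim/spin_ind=> a; elim/spin_ind=> b; elim/spin_ind=> c.
by rewrite !(spin_mulE, spin_addE); apply/spin_classP/srel_mulDl.
Qed.
Lemma spin_mulrDr : right_distributive spin_mul spin_add.
Proof.
elim/spin_ind=> a; elim/spin_ind=> b; elim/spin_ind=> c.
by rewrite !(spin_mulE, spin_addE); apply/spin_classP/srel_mulDr.
Qed.
HB.instance Definition _ := GRing.Zmodule_isPzRing.Build spin_alg
  spin_mulrA spin_mul1r spin_mulr1 spin_mulrDl spin_mulrDr.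

Lemma spin_scalerA x y u : spin_scale x (spin_scale y u) = spin_scale (x * y) u.
Proof.
elim/spin_ind: u => a; rewrite !spin_scaleE; apply/spin_classP.
apply: srel_trans (srel_mulA _ _ _ _) _; apply: srel_mul (srel_refl _ _).
exact/srel_sym/srel_cstM.
Qed.
Lemma spin_scale1r : left_id 1 spin_scale.
Proof. by elim/spin_ind=> a; rewrite spin_scaleE; apply/spin_classP/srel_mul1l. Qed.
Lemma spin_scalerDr : right_distributive spin_scale +%R.
Proof.
move=> x; elim/spin_ind=> a; elim/spin_ind=> b.
rewrite /GRing.add /= !(spin_scaleE, spin_addE); exact/spin_classP/srel_mulDr.
Qed.
Lemma spin_scalerDl u : {morph spin_scale^~ u : x y / x + y}.
Proof.
move=> x y; elim/spin_ind: u => a.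
rewrite [RHS]/GRing.add /= !(spin_scaleE, spin_addE); apply/spin_classP.
apply: srel_trans (srel_mulDl _ _ _ _); apply: srel_mul (srel_refl _ _).
exact: srel_cstD.
Qed.
HB.instance Definition _ := GRing.Zmodule_isLmodule.Build R[i] spin_alg
  spin_scalerA spin_scale1r spin_scalerDr spin_scalerDl.

Definition spin_gen (p : I) : spin_alg := spin_class (SGen p).


(* The left regular representation in the basis (x_A), A running over the
   subsets of I: x_p x_A = (prod_(q in A, q < p) e p q) x_(A + {p}). *)
Local Notation N := #|{set I}|.

Definition spin_flip (p : I) (a : 'I_N) : 'I_N :=
  enum_rank [set q | (q == p) (+) (q \in enum_val a)]%SET.

Definition spin_sgn (p : I) (a : 'I_N) : R :=
  \prod_(q in enum_val a | (q < p)%O) e p q.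

Definition spin_lgen (p : I) : 'M[R[i]]_N :=
  \matrix_(a, b) ((spin_sgn p a)%:C *+ (b == spin_flip p a)).

Fixpoint spin_lterm (t : sterm R I) : 'M[R[i]]_N :=
  match t with
  | SGen p => spin_lgen p
  | SCst x => x%:M
  | SAdd a b => spin_lterm a + spin_lterm b
  | SMul a b => spin_lterm a *m spin_lterm b
  | SAdj a => (map_mx Num.conj (spin_lterm a))^T
  end.

Lemma spin_in_flip p q a :
  (q \in enum_val (spin_flip p a)) = (q == p) (+) (q \in enum_val a).
Proof. by rewrite /spin_flip enum_rankK inE. Qed.

Lemma spin_flipK p : involutive (spin_flip p).
Proof.
move=> a; apply: enum_val_inj; apply/finset.setP => q.
by rewrite !spin_in_flip; case: (q == p); case: (q \in _).
Qed.

Lemma spin_flipC p q a : spin_flip p (spin_flip q a) = spin_flip q (spin_flip p a).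
Proof.
apply: enum_val_inj; apply/finset.setP => r.
by rewrite !spin_in_flip; case: (r == p); case: (r == q); case: (r \in _).
Qed.

Lemma signfun_sqr p q : e p q * e p q = 1.
Proof. by case: (signfunP e p q) => ->; rewrite ?mulrNN mulr1. Qed.

Lemma spin_sgn_sqr p a : spin_sgn p a * spin_sgn p a = 1.
Proof. by rewrite /spin_sgn -big_split big1 //= => q _; exact: signfun_sqr. Qed.

Lemma spin_sgn_flip p q a :
  spin_sgn p (spin_flip q a) = (if (q < p)%O then e p q else 1) * spin_sgn p a.
Proof.
rewrite /spin_sgn; case: ifPn => qp; last first.
  rewrite mul1r; apply: eq_bigl => r; rewrite spin_in_flip.
  by case: eqVneq => [->|]//=; rewrite (negPf qp) !andbF.
have E (b : 'I_N) : \prod_(r in enum_val b | (r < p)%O) e p r =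
    (if q \in enum_val b then e p q else 1) *
    \prod_(r in enum_val b | (r < p)%O && (r != q)) e p r.
  case: ifPn => qb; first by rewrite (bigD1 q) ?qb //=; congr (_ * _); apply: eq_bigl => r; rewrite andbA.
  rewrite mul1r; apply: eq_bigl => r.
  by case: (eqVneq r q) => [->|]; rewrite ?(negPf qb) ?andbT.
rewrite E [in RHS]E spin_in_flip eqxx /= mulrA; congr (_ * _).
  by case: (q \in _); rewrite /= ?mulr1 ?signfun_sqr.
by apply: eq_bigl => r; rewrite spin_in_flip; case: (eqVneq r q); rewrite ?andbF //= addFb.
Qed.

Lemma spin_lgen_mul p (M : 'M[R[i]]_N) a c :
  (spin_lgen p *m M) a c = (spin_sgn p a)%:C * M (spin_flip p a) c.
Proof.
rewrite mxE (bigD1 (spin_flip p a)) //= big1 ?addr0 => [|b /negPf bN];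
  by rewrite mxE ?eqxx ?bN ?mulr0n ?mul0r.
Qed.

Lemma spin_lgen_comm p q : spin_lgen p *m spin_lgen q +
  (- (e p q)%:C) *: (spin_lgen q *m spin_lgen p) = (2 * (p == q)%:R)%:M.
Proof.
apply/matrixP => a c.
rewrite mxE [X in _ + X]mxE !spin_lgen_mul !mxE (spin_flipC q) !spin_sgn_flip.
set b := (c == _); rewrite [X in X + _ = _]mulrnAr [in X in _ + X = _]mulrnAr [X in _ + X = _]mulrnAr -mulrnDl.
rewrite !mulrA -!rmorphM /= -rmorphN -!rmorphM -rmorphD /=.
have [pq|pq|pq] := ltgtP p q.
- rewrite /= mulr0 mul0rn (signfunC e q p).
  have -> : spin_sgn p a * (e p q * spin_sgn q a) + -
    e p q * spin_sgn q a * (1 * spin_sgn p a) = 0 by ring.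
  by rewrite mul0rn.
- rewrite /= mulr0 mul0rn.
  have -> : spin_sgn p a * (1 * spin_sgn q a) + -
    e p q * spin_sgn q a * (e p q * spin_sgn p a)
    = spin_sgn p a * spin_sgn q a * (1 - e p q * e p q) by ring.
  by rewrite signfun_sqr subrr mulr0 mul0rn.
- rewrite /b pq signfun_diag spin_flipK /= mulr1 (eq_sym c); congr (_ *+ _).
  have -> : spin_sgn q a * (1 * spin_sgn q a) +
    - -1 * spin_sgn q a * (1 * spin_sgn q a)
    = 2 * (spin_sgn q a * spin_sgn q a) by ring.
  by rewrite spin_sgn_sqr mulr1 rmorph_nat.
Qed.

Lemma spin_lgen_adj p : (map_mx Num.conj (spin_lgen p))^T = spin_lgen p.
Proof.
apply/matrixP => a b; rewrite !mxE rmorphMn /=.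
rewrite -(inj_eq (can_inj (spin_flipK p)) a) spin_flipK eq_sym.
have [->|_] := eqVneq b (spin_flip p a); last by rewrite !mulr0n.
by rewrite spin_sgn_flip ltxx mul1r; congr (_ *+ _); exact: conjc_real.
Qed.

Lemma spin_ltermP a b : spin_rel e a b -> spin_lterm a = spin_lterm b.
Proof.
elim=> {a b} //=.
- by move=> a b c _ -> _ ->.
- by move=> a a' b b' _ -> _ ->.
- by move=> a a' b b' _ -> _ ->.
- by move=> a a' _ ->.
- by move=> a b c; rewrite addrA.
- by move=> a b; rewrite addrC.
- by move=> a; rewrite raddf0 add0r.
- by move=> a; rewrite mul_scalar_mx scaleN1r addNr raddf0.
- by move=> a b c; rewrite mulmxA.
- by move=> a; rewrite mul1mx.
- by move=> a; rewrite mulmx1.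
- by move=> a b c; rewrite mulmxDl.
- by move=> a b c; rewrite mulmxDr.
- by move=> x y; rewrite raddfD.
- by move=> x y; rewrite scalar_mxM.
- by move=> x a; rewrite scalar_mxC.
- by move=> x; rewrite map_scalar_mx tr_scalar_mx.
- by move=> a b; rewrite map_mxD linearD.
- by move=> a b; rewrite map_mxM trmx_mul.
- by move=> a; rewrite map_trmx trmxK; apply/matrixP => i j; rewrite !mxE conjCK.
- by move=> p; rewrite spin_lgen_adj.
- by move=> p q; rewrite mul_scalar_mx spin_lgen_comm.
Qed.

Definition spin_lrep (u : spin_alg) : 'M[R[i]]_N := spin_lterm (spin_repr u).

Lemma spin_lrepE a : spin_lrep (spin_class a) = spin_lterm a.
Proof. exact/spin_ltermP/spin_repr_class. Qed.

Lemma spin_lrepD u v : spin_lrep (u + v) = spin_lrep u + spin_lrep v.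
Proof. exact: (spin_lrepE (SAdd _ _)). Qed.
Lemma spin_lrepM u v : spin_lrep (u * v) = spin_lrep u *m spin_lrep v.
Proof. exact: (spin_lrepE (SMul _ _)). Qed.
Lemma spin_lrepZ x u : spin_lrep (x *: u) = x *: spin_lrep u.
Proof. by rewrite -mul_scalar_mx; exact: (spin_lrepE (SMul (SCst x) _)). Qed.
Lemma spin_lrep1 : spin_lrep 1 = 1%:M.
Proof. exact: (spin_lrepE (SCst 1)). Qed.
Lemma spin_lrep_adj u : spin_lrep (spin_adj u) = (map_mx Num.conj (spin_lrep u))^T.
Proof. exact: (spin_lrepE (SAdj _)). Qed.
Lemma spin_lrep_gen p : spin_lrep (spin_gen p) = spin_lgen p.
Proof. exact: (spin_lrepE (SGen p)). Qed.

Lemma spin_card_gt0 : (0 < N)%N.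
Proof. by apply/card_gt0P; exists finset.set0. Qed.

Lemma spin_oner_neq0 : 1 != 0 :> spin_alg.
Proof.
apply/eqP => E.
have /(congr1 (fun M : 'M[R[i]]_N => M (Ordinal spin_card_gt0) (Ordinal spin_card_gt0))) :
  spin_lrep 1 = 0 *: spin_lrep 1 by rewrite -spin_lrepZ scale0r E.
by rewrite spin_lrep1 !mxE eqxx mul0r => /eqP; rewrite oner_eq0.
Qed.
HB.instance Definition _ := GRing.PzSemiRing_isNonZero.Build spin_alg spin_oner_neq0.

Lemma spin_scalerAl (x : R[i]) (u v : spin_alg) : x *: (u * v) = x *: u * v.
Proof.
elim/spin_ind: u => a; elim/spin_ind: v => b.
rewrite /GRing.scale /GRing.mul /= !(spin_mulE, spin_scaleE).
exact/spin_classP/srel_mulA.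
Qed.
HB.instance Definition _ := GRing.Lmodule_isLalgebra.Build R[i] spin_alg spin_scalerAl.

Lemma spin_scalerAr (x : R[i]) (u v : spin_alg) : x *: (u * v) = u * (x *: v).
Proof.
elim/spin_ind: u => a; elim/spin_ind: v => b.
rewrite /GRing.scale /GRing.mul /= !(spin_mulE, spin_scaleE); apply/spin_classP.
apply: srel_trans (srel_mulA _ _ _ _) _; apply: srel_trans; last first.
  exact/srel_sym/srel_mulA.
by apply: srel_mul (srel_refl _ _); exact: srel_cstC.
Qed.
HB.instance Definition _ := GRing.Lalgebra_isAlgebra.Build R[i] spin_alg spin_scalerAr.

Lemma spin_gen_adj p : spin_adj (spin_gen p) = spin_gen p.
Proof. by rewrite spin_adjE; apply/spin_classP/srel_adj_gen. Qed.

Lemma spin_cstE x : spin_cst x = x%:A.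
Proof.
by rewrite /GRing.scale /= spin_scaleE; apply/spin_classP/srel_sym/srel_mul1r.
Qed.

Lemma spin_gen_comm p q :
  spin_gen p * spin_gen q - (e p q)%:C *: (spin_gen q * spin_gen p)
  = (2 * (p == q)%:R)%:A.
Proof.
have addE a b : spin_class a + spin_class b = spin_class (SAdd a b) := spin_addE a b.
have mulE a b : spin_class a * spin_class b = spin_class (SMul a b) := spin_mulE a b.
have scaleE x a : x *: spin_class a = spin_class (SMul (SCst x) a) := spin_scaleE x a.
rewrite -spin_cstE -scaleNr /spin_gen (mulE (SGen p) (SGen q)) (mulE (SGen q) (SGen p)).
rewrite (scaleE _ (SMul _ _)) (addE (SMul _ _) (SMul _ _)).
exact/spin_classP/srel_comm.
Qed.

(* x_A, the product of the generators indexed by A in increasing order *)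
Definition spin_mon (A : {set I}) : spin_alg :=
  \prod_(p <- sort <=%O (enum A)) spin_gen p.

(* The trace is realized as the normalized trace of the left regular
   representation; by spin_tau_mon and spin_tau_unique it is the linear
   functional with value delta_{A,0} on x_A. *)
Definition spin_tau (u : spin_alg) : R[i] := \tr (spin_lrep u) / N%:R.

Lemma spin_tau_linear : linear_for *%R spin_tau.
Proof.
move=> x u v; rewrite /spin_tau spin_lrepD spin_lrepZ mxtraceD mxtraceZ.
by rewrite mulrDl mulrA.
Qed.
HB.instance Definition _ := GRing.isLinear.Build R[i] spin_alg R[i] *%R spin_tau
  spin_tau_linear.

Lemma spin_tauC u v : spin_tau (u * v) = spin_tau (v * u).
Proof. by rewrite /spin_tau !spin_lrepM mxtrace_mulC. Qed.

Lemma spin_tau_ge0 u : 0 <= spin_tau (spin_adj u * u).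
Proof.
rewrite /spin_tau spin_lrepM spin_lrep_adj mulr_ge0 ?invr_ge0 ?ler0n //.
apply: sumr_ge0 => a _; rewrite mxE; apply: sumr_ge0 => b _.
by rewrite !mxE mulrC mul_conjC_ge0.
Qed.

Lemma spin_lmonE (s : seq I) (a c : 'I_N) : uniq s -> 
   spin_lrep (\prod_(p <- s) spin_gen p) a c != 0 ->
   enum_val c = [set q | (q \in s) (+) (q \in enum_val a)]%SET.
Proof.
elim: s a => [|p s IH] a /=.
  move=> _; rewrite big_nil spin_lrep1 mxE.
  have [-> _|_] := eqVneq a c; last by rewrite eqxx.
  by apply/finset.setP => q; rewrite inE.
move=> /andP[ps us]; rewrite big_cons spin_lrepM spin_lrep_gen spin_lgen_mul.
rewrite mulf_eq0 negb_or => /andP[_ /(IH _ us) ->].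
apply/finset.setP => q; rewrite !inE spin_in_flip.
by case: (eqVneq q p) => [->|]; rewrite ?(negPf ps).
Qed.

Lemma spin_tau_mon A : spin_tau (spin_mon A) = (A == finset.set0)%:R.
Proof.
rewrite /spin_tau; have N0 : N%:R != 0 :> R[i].
  by rewrite pnatr_eq0 -lt0n spin_card_gt0.
have [->|An0] := eqVneq.
  rewrite /spin_mon enum_set0 /= big_nil spin_lrep1 mxtrace1 divff //.
suff -> : \tr (spin_lrep (spin_mon A)) = 0 by rewrite mul0r.
apply: big1 => a _; apply/eqP; apply: contraNT An0.
move=> /spin_lmonE -/(_ (Order.enum_uniq _)).
move=> /finset.setP E; apply/eqP/finset.setP => q; move: (E q).
rewrite !inE Order.mem_enum; by case: (q \in A); case: (_ \in _).
Qed.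

Lemma spin_gen_sqr p : spin_gen p * spin_gen p = 1.
Proof.
have := spin_gen_comm p p; rewrite signfun_diag eqxx mulr1 rmorphN1 scaleN1r opprK.
rewrite -mulr2n -scaler_nat => /(congr1 (fun u => 2^-1 *: u)).
by rewrite !scalerA mulVf ?pnatr_eq0 // !scale1r.
Qed.

Lemma spin_gen_swap p q : p != q ->
  spin_gen p * spin_gen q = (e p q)%:C *: (spin_gen q * spin_gen p).
Proof.
move=> /negPf pq; have := spin_gen_comm p q.
by rewrite pq mulr0 scale0r => /eqP; rewrite subr_eq0 => /eqP.
Qed.

Lemma spin_gen_insert p (s : seq I) : sorted <%O s -> exists c s',
  [/\ spin_gen p * \prod_(q <- s) spin_gen q = c *: \prod_(q <- s') spin_gen q,
      sorted <%O s' & {subset s' <= p :: s}].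
Proof.
elim: s => [|q s IH] sq.
  by exists 1, [:: p]; split => //; rewrite big_nil big_seq1 mulr1 scale1r.
have [pq|qp|->] := ltgtP p q.
- exists 1, [:: p, q & s]; split => //=; first by rewrite !big_cons scale1r.
  by rewrite pq.
- have [c [s' [E ss' sub]]] := IH (path_sorted sq).
  exists ((e p q)%:C * c), (q :: s'); split.
  + by rewrite !big_cons mulrA spin_gen_swap ?gt_eqF // -scalerAl -mulrA E -scalerAr scalerA.
  + rewrite /= path_min_sorted //; apply/allP => r /sub; rewrite inE => /orP[/eqP->//|].
    by move: sq => /=; rewrite lt_path_sortedE => /andP[/allP h _]; exact: h.
  + by move=> r; rewrite !inE => /orP[->|/sub]; rewrite ?orbT // inE => /orP[->|->]; rewrite ?orbT.
- exists 1, s; split; first by rewrite big_cons mulrA spin_gen_sqr mul1r scale1r.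
    exact: path_sorted sq.
  by move=> r rs; rewrite !inE rs !orbT.
Qed.

Definition spin_spanned (u : spin_alg) :=
  exists c : {set I} -> R[i], u = \sum_A c A *: spin_mon A.

Lemma spin_spannedD u v : spin_spanned u -> spin_spanned v -> spin_spanned (u + v).
Proof.
move=> [c ->] [c' ->]; exists (fun A => c A + c' A).
by rewrite -big_split; apply: eq_bigr => A _; rewrite scalerDl.
Qed.

Lemma spin_spannedZ x u : spin_spanned u -> spin_spanned (x *: u).
Proof.
move=> [c ->]; exists (fun A => x * c A).
by rewrite scaler_sumr; apply: eq_bigr => A _; rewrite scalerA.
Qed.

Lemma spin_spanned_prod (s : seq I) : sorted <%O s ->
  spin_spanned (\prod_(q <- s) spin_gen q).
Proof.
move=> ss; exists (fun A => (A == [set q in s]%SET)%:R).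
rewrite [RHS](bigD1 [set q in s]%SET) //= eqxx scale1r [X in _ + X]big1 ?addr0.
  rewrite /spin_mon; have -> // : sort <=%O (enum [set q in s]%SET) = s.
  apply: lt_sorted_eq => //; first by rewrite sort_lt_sorted enum_uniq.
  by move=> q; rewrite mem_sort mem_enum inE.
by move=> A /negPf ->; rewrite scale0r.
Qed.

Lemma spin_spanned_genM p u : spin_spanned u -> spin_spanned (spin_gen p * u).
Proof.
move=> [c ->]; rewrite mulr_sumr; apply: (big_ind spin_spanned).
- by exists (fun _ => 0); rewrite big1 // => A _; rewrite scale0r.
- exact: spin_spannedD.
- move=> A _; rewrite -scalerAr; apply: spin_spannedZ.
  have sA : sorted <%O (sort <=%O (enum A)) by rewrite sort_lt_sorted enum_uniq.
  have [c' [s' [E ss' _]]] := spin_gen_insert p sA.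
  by rewrite /spin_mon E; apply/spin_spannedZ/spin_spanned_prod.
Qed.

Lemma spin_mon_span (u : spin_alg) : spin_spanned u.
Proof.
have H a : forall v, spin_spanned v ->
    spin_spanned (spin_class a * v) /\ spin_spanned (spin_adj (spin_class a) * v).
  elim: a => [p|x|a IHa b IHb|a IHa b IHb|a IHa] v sv.
  - by rewrite -/(spin_gen p) spin_gen_adj; split; exact: spin_spanned_genM.
  - rewrite spin_adjE; have -> : spin_class (SAdj (SCst x)) = spin_cst (Num.conj x).
      exact/spin_classP/srel_adj_cst.
    rewrite -/(spin_cst x) !spin_cstE -!scalerAl !mul1r.
    by split; exact: spin_spannedZ.
  - rewrite -spin_addE.
    have -> : spin_adj (spin_add (spin_class a) (spin_class b)) =
        spin_adj (spin_class a) + spin_adj (spin_class b).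
      rewrite spin_addE !spin_adjE; apply: etrans (esym (spin_addE _ _)).
      exact/spin_classP/srel_adjD.
    rewrite -/(spin_class a + spin_class b) !mulrDl.
    by split; apply: spin_spannedD; [apply IHa|apply IHb|apply IHa|apply IHb].
  - have -> : spin_adj (spin_class (SMul a b)) =
        spin_adj (spin_class b) * spin_adj (spin_class a).
      rewrite !spin_adjE; apply: etrans (esym (spin_mulE _ _)).
      exact/spin_classP/srel_adjM.
    rewrite -spin_mulE -/(spin_class a * spin_class b) -!mulrA.
    split; first by apply IHa; apply IHb.
    by apply IHb; apply IHa.
  - have -> : spin_adj (spin_class (SAdj a)) = spin_class a.
      by rewrite spin_adjE; apply/spin_classP/srel_adjK.
    by rewrite -spin_adjE; split; apply IHa.
have s1 : spin_spanned 1 by have := @spin_spanned_prod [::] isT; rewrite big_nil.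
by elim/spin_ind: u => a; have [h _] := H a 1 s1; rewrite mulr1 in h.
Qed.

Lemma spin_adjM u v : spin_adj (u * v) = spin_adj v * spin_adj u.
Proof.
elim/spin_ind: u => a; elim/spin_ind: v => b.
rewrite [in LHS]/GRing.mul /= spin_mulE !spin_adjE.
apply: etrans (esym (spin_mulE _ _)); exact/spin_classP/srel_adjM.
Qed.

Lemma spin_adj1 : spin_adj 1 = 1.
Proof.
rewrite /GRing.one /= /spin_cst spin_adjE; apply/spin_classP.
by have := srel_adj_cst e 1; rewrite rmorph1.
Qed.

Lemma spin_mon_orthonormal A B :
  spin_tau (spin_adj (spin_mon A) * spin_mon B) = (A == B)%:R.
Proof.
have [->|AB] := eqVneq A B.
  suff -> : spin_adj (spin_mon B) * spin_mon B = 1.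
    by have := spin_tau_mon finset.set0; rewrite /spin_mon enum_set0 /= big_nil eqxx.
  rewrite /spin_mon; elim: (sort _ _) => [|p s IH].
    by rewrite big_nil spin_adj1 mulr1.
  by rewrite big_cons spin_adjM spin_gen_adj -mulrA (mulrA (spin_gen p)) spin_gen_sqr mul1r.
rewrite /spin_tau spin_lrepM spin_lrep_adj /mxtrace big1 ?mul0r // => a _.
rewrite mxE big1 // => b _; rewrite !mxE.
have [->|/spin_lmonE -/(_ (Order.enum_uniq _)) EA] :=
  eqVneq (spin_lrep (spin_mon A) b a) 0; first by rewrite rmorph0 mul0r.
have [->|/spin_lmonE -/(_ (Order.enum_uniq _)) EB] :=
  eqVneq (spin_lrep (spin_mon B) b a) 0; first by rewrite mulr0.
case/eqP: AB; apply/finset.setP => q; move: EA; rewrite EB => /finset.setP/(_ q).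
by rewrite !inE !Order.mem_enum; case: (q \in A); case: (q \in B); case: (_ \in _).
Qed.

Lemma spin_fourier u : u = \sum_A spin_tau (spin_adj (spin_mon A) * u) *: spin_mon A.
Proof.
have [c ->] := spin_mon_span u; apply: eq_bigr => A _; congr (_ *: _).
rewrite mulr_sumr linear_sum (bigD1 A) //= -scalerAr linearZ /= spin_mon_orthonormal.
rewrite eqxx mulr1 big1 ?addr0 // => B /negPf BA.
by rewrite -scalerAr linearZ /= spin_mon_orthonormal eq_sym BA mulr0.
Qed.

Lemma spin_tau_unique (f : spin_alg -> R[i]) : linear_for *%R f ->
  (forall A, f (spin_mon A) = (A == finset.set0)%:R) -> f =1 spin_tau.
Proof.
move=> lf fA u; have [c ->] := spin_mon_span u.
pose F := GRing.isLinear.Build R[i] spin_alg R[i] *%R f lf.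
pose fL : {linear spin_alg -> R[i] | *%R} := HB.pack f F.
rewrite -[f]/(fL : _ -> _) !linear_sum; apply: eq_bigr => A _.
by rewrite !linearZ /= fA spin_tau_mon.
Qed.

End SpinAlg.

Section Ell2.
Context {R : realType} {W : choiceType}.
Local Notation C := R[i]^o.

Definition csqnorm (z : R[i]) : R := complex.Re z ^+ 2 + complex.Im z ^+ 2.

Definition l2sq (f : W -> C) : \bar R := \esum_(w in [set: W]) (csqnorm (f w))%:E.

Lemma csqnorm_ge0 z : 0 <= csqnorm z.
Proof. by rewrite addr_ge0 ?sqr_ge0. Qed.

Lemma csqnormD x y : csqnorm (x + y) <= 2 * (csqnorm x + csqnorm y).
Proof.
case: x y => [a b] [c d]; rewrite /csqnorm /= -subr_ge0.
have -> : 2 * (a ^+ 2 + b ^+ 2 + (c ^+ 2 + d ^+ 2)) - ((a + c) ^+ 2 + (b + d) ^+ 2)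
  = (a - c) ^+ 2 + (b - d) ^+ 2 by ring.
by rewrite addr_ge0 ?sqr_ge0.
Qed.

Lemma csqnormM x y : csqnorm (x * y) = csqnorm x * csqnorm y.
Proof. by case: x y => [a b] [c d]; rewrite /csqnorm /=; ring. Qed.

Lemma l2sq_ge0 f : (0 <= l2sq f)%E.
Proof. by apply: esum_ge0 => w _; rewrite lee_fin csqnorm_ge0. Qed.

Lemma esumZ (k : R) (f : W -> R) : 0 <= k -> (forall w, 0 <= f w) ->
  (\esum_(w in [set: W]) (k * f w)%:E <= k%:E * \esum_(w in [set: W]) (f w)%:E)%E.
Proof.
move=> k0 f0; apply: ge_ereal_sup => _ [X [finX _] <-].
under eq_fsbigr do rewrite EFinM.
rewrite -ge0_mule_fsumr => [|w]; last by rewrite lee_fin f0.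
apply: lee_wpmul2l; first by rewrite lee_fin.
by apply: ereal_sup_ubound; exists X.
Qed.

Lemma l2sqZ (x : R[i]) f : (l2sq (x *: f)%R <= (csqnorm x)%:E * l2sq f)%E.
Proof.
apply: le_trans (esumZ (csqnorm_ge0 x) (fun w => csqnorm_ge0 (f w))).
by apply: le_esum => w _; rewrite lee_fin -csqnormM.
Qed.

Lemma l2sqD f g : (l2sq (f + g)%R <= 2%:E * (l2sq f + l2sq g))%E.
Proof.
rewrite /l2sq -esumD; try by move=> w _; rewrite lee_fin csqnorm_ge0.
have H w : 0 <= csqnorm (f w) + csqnorm (g w) by rewrite addr_ge0 ?csqnorm_ge0.
apply: le_trans (esumZ (ler0n R 2) H).
by apply: le_esum => w _; rewrite lee_fin csqnormD.
Qed.

Definition square_summable (f : W -> C) : bool := `[< (l2sq f < +oo)%E >].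

Lemma square_summable_submod : submod_closed square_summable.
Proof.
split=> [|x f g /asboolP ff /asboolP gf].
  apply/asboolP; rewrite /l2sq esum1 ?ltry // => w _.
  by rewrite /csqnorm /= !expr0n /= addr0.
have fin (y : \bar R) k : (0 <= y)%E -> (y < +oo)%E -> (k%:E * y < +oo)%E.
  by case: y => // y _ _; rewrite -EFinM ltry.
apply/asboolP; apply: le_lt_trans (l2sqD _ _) _; apply: (fin _ 2).
  by rewrite adde_ge0 ?l2sq_ge0.
rewrite lte_add_pinfty //; apply: le_lt_trans (l2sqZ _ _) _.
exact: (fin _ (csqnorm x) (l2sq_ge0 f) ff).
Qed.
HB.instance Definition _ := GRing.isSubmodClosed.Build R[i] (W -> C) square_summable
  square_summable_submod.

Record ell2 := Ell2 { ell2_val :> W -> C ; _ : square_summable ell2_val }.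
HB.instance Definition _ := [isSub for ell2_val].
HB.instance Definition _ := [Choice of ell2 by <:].
HB.instance Definition _ := [SubChoice_isSubLmodule of ell2 by <:].

Lemma ell2P (f : ell2) : (l2sq f < +oo)%E.
Proof. by case: f => f fP; exact/asboolP. Qed.

Lemma ell2_delta_subproof (w0 : W) : square_summable (fun w => (w == w0)%:R).
Proof.
apply/asboolP; rewrite /l2sq (esumID [set w0]); last first.
  by move=> w _; rewrite lee_fin csqnorm_ge0.
rewrite setTI esum_set1 ?lee_fin ?csqnorm_ge0 // esum1 ?adde0 ?ltry // => w [_ /eqP].
by move=> /negPf ->; rewrite /csqnorm /= !expr0n /= addr0.
Qed.
Definition ell2_delta (w0 : W) : ell2 := Ell2 (ell2_delta_subproof w0).

Definition bounded_linear (T : ell2 -> ell2) : Prop :=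
  linear T /\ exists K : R, forall f, (l2sq (T f) <= K%:E * l2sq f)%E.

Definition commutant (S : set (ell2 -> ell2)) : set (ell2 -> ell2) :=
  [set T | bounded_linear T /\ forall U, S U -> T \o U = U \o T].

Lemma bounded_linear_0 T : bounded_linear T -> T 0 = 0.
Proof.
by move=> [lT _]; have := lT (-1) 0 0; rewrite !scaleN1r !addNr.
Qed.

Lemma bounded_linear_D T f g : bounded_linear T -> T (f + g) = T f + T g.
Proof. by move=> [lT _]; have := lT 1 f g; rewrite !scale1r. Qed.

Lemma bounded_linear_Z T x f : bounded_linear T -> T (x *: f) = x *: T f.
Proof. by move=> bT; have := bT.1 x f 0; rewrite !addr0 bounded_linear_0 // addr0. Qed.

Lemma bounded_linear_id : bounded_linear idfun.
Proof. by split=> //; exists 1 => f; rewrite mul1e. Qed.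

Lemma bounded_linear_comp T U :
  bounded_linear T -> bounded_linear U -> bounded_linear (T \o U).
Proof.
move=> [lT [K bT]] [lU [L bU]]; split=> [x f g|]; first by rewrite /= lU lT.
exists (`|K| * L) => f; apply: le_trans (bT _) _.
apply: (@le_trans _ _ (`|K|%:E * l2sq (U f))%E).
  by apply: lee_wpmul2r; rewrite ?l2sq_ge0 // lee_fin ler_norm.
rewrite EFinM -muleA; apply: lee_wpmul2l (bU f); by rewrite lee_fin.
Qed.

Lemma bounded_linear0 : bounded_linear 0.
Proof.
split=> [x f g|]; first by rewrite -[RHS]/(x *: (0 : ell2) + 0) scaler0 addr0.
exists 0 => f; rewrite mul0e /l2sq esum1 // => w _.
by rewrite /csqnorm /= !expr0n /= addr0.
Qed.

Lemma bounded_linearZD (x : R[i]) T U :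
  bounded_linear T -> bounded_linear U -> bounded_linear (x *: T + U).
Proof.
move=> [lT [K bT]] [lU [L bU]]; split=> [y f g|].
  rewrite -[LHS]/(x *: T (y *: f + g) + U (y *: f + g)).
  rewrite -[RHS]/(y *: (x *: T f + U f) + (x *: T g + U g)).
  by rewrite lT lU !scalerDr !scalerA (mulrC x) addrACA.
exists (2 * (csqnorm x * `|K| + `|L|)) => f.
have {}bT g : (l2sq (T g) <= `|K|%:E * l2sq g)%E.
  by apply: le_trans (bT g) _; apply: lee_wpmul2r; rewrite ?l2sq_ge0 // lee_fin ler_norm.
have {}bU g : (l2sq (U g) <= `|L|%:E * l2sq g)%E.
  by apply: le_trans (bU g) _; apply: lee_wpmul2r; rewrite ?l2sq_ge0 // lee_fin ler_norm.
apply: le_trans (l2sqD _ _) _; rewrite EFinM -muleA.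
apply: lee_wpmul2l; first by rewrite lee_fin.
rewrite EFinD ge0_muleDl ?lee_fin ?mulr_ge0 ?csqnorm_ge0 //.
apply: leeD (bU f); apply: le_trans (l2sqZ _ _) _.
rewrite EFinM -muleA; apply: lee_wpmul2l (bT f); by rewrite lee_fin csqnorm_ge0.
Qed.

End Ell2.
Arguments ell2 : clear implicits.

(* The von Neumann algebra S'' of a self-adjoint set S of bounded operators
   on l^2(W) *)
Section VNAlgebra.
Context {R : realType} {W : pointedType} (S : set (ell2 R W -> ell2 R W)).

Definition bicommutant (T : ell2 R W -> ell2 R W) : bool :=
  `[< commutant (commutant S) T >].

Lemma bicommutant_submod : submod_closed bicommutant.
Proof.
split=> [|x T U /asboolP[bT cT] /asboolP[bU cU]]; apply/asboolP.
  split=> [|U [bU _]]; first exact: bounded_linear0.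
  by apply/funext => f; rewrite -[RHS]/(U 0) bounded_linear_0.
split=> [|V SV]; first exact: bounded_linearZD.
have [lV _] := SV.1; apply/funext => f.
rewrite -[LHS]/(x *: (T \o V) f + (U \o V) f) cT // cU //.
by rewrite -[RHS]/(V (x *: T f + U f)) lV.
Qed.
HB.instance Definition _ := GRing.isSubmodClosed.Build R[i] (ell2 R W -> ell2 R W)
  bicommutant bicommutant_submod.

Record vN_alg := VNAlg { vN_val :> ell2 R W -> ell2 R W ; _ : bicommutant vN_val }.
HB.instance Definition _ := [isSub for vN_val].
HB.instance Definition _ := [Choice of vN_alg by <:].
HB.instance Definition _ := [SubChoice_isSubLmodule of vN_alg by <:].

Lemma vN_algP (T : vN_alg) : commutant (commutant S) T.
Proof. by case: T => T TP; exact/asboolP. Qed.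

Lemma vN_one_subproof : bicommutant idfun.
Proof. by apply/asboolP; split=> [|//]; exact: bounded_linear_id. Qed.
Definition vN_one : vN_alg := VNAlg vN_one_subproof.

Lemma vN_mul_subproof (T U : vN_alg) : bicommutant (T \o U).
Proof.
have [bT cT] := vN_algP T; have [bU cU] := vN_algP U.
apply/asboolP; split=> [|V SV]; first exact: bounded_linear_comp.
by rewrite -compA cU // compA cT.
Qed.
Definition vN_mul (T U : vN_alg) : vN_alg := VNAlg (vN_mul_subproof T U).

Lemma vN_mulA : associative vN_mul. Proof. by move=> T U V; apply: val_inj. Qed.
Lemma vN_mul1 : left_id vN_one vN_mul. Proof. by move=> T; apply: val_inj. Qed.
Lemma vN_mulr1 : right_id vN_one vN_mul. Proof. by move=> T; apply: val_inj. Qed.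
Lemma vN_mulDl : left_distributive vN_mul +%R.
Proof. by move=> T U V; apply: val_inj. Qed.
Lemma vN_mulDr : right_distributive vN_mul +%R.
Proof.
move=> T U V; apply: val_inj; apply/funext => f.
have [bT _] := vN_algP T.
by rewrite -[LHS]/(T (U f + V f)) bounded_linear_D.
Qed.
Lemma vN_one_neq0 : vN_one != 0.
Proof.
apply/eqP => /(congr1 (fun T : vN_alg => T (ell2_delta point) point)).
rewrite -[LHS]/((point == point :> W)%:R : R[i]) -[RHS]/(0 : R[i]) eqxx.
by move=> /eqP; rewrite oner_eq0.
Qed.
HB.instance Definition _ := GRing.Zmodule_isNzRing.Build vN_alg
  vN_mulA vN_mul1 vN_mulr1 vN_mulDl vN_mulDr vN_one_neq0.

Lemma vN_scaleAl (x : R[i]) (T U : vN_alg) : x *: (T * U) = x *: T * U.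
Proof. by apply: val_inj. Qed.
HB.instance Definition _ := GRing.Lmodule_isLalgebra.Build R[i] vN_alg vN_scaleAl.
Lemma vN_scaleAr (x : R[i]) (T U : vN_alg) : x *: (T * U) = T * (x *: U).
Proof.
apply: val_inj; apply/funext => f.
have [bT _] := vN_algP T.
by rewrite -[RHS]/(T (x *: U f)) bounded_linear_Z.
Qed.
HB.instance Definition _ := GRing.Lalgebra_isAlgebra.Build R[i] vN_alg vN_scaleAr.

(* the vector state <T e_w, e_w> *)
Definition vN_state (w : W) (T : vN_alg) : R[i] := T (ell2_delta w) w.

End VNAlgebra.

Section FpWords.
Context (n d : nat).
Local Notation letter := ('I_n * {set 'I_d})%type.

Definition fp_reduced (w : seq letter) : bool :=
  all (fun u => u.2 != finset.set0) w && sorted (fun u v => u.1 != v.1) w.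

(* Since (x_A)_A is an orthonormal basis of L^2(C(R^d)) with x_0 = 1, the reduced
   words index the orthonormal basis of the free product Hilbert space
   C Omega + sum of the L^2_0 (x) ... (x) L^2_0 over alternating labels; the empty
   word is the vacuum Omega. *)
Record fp_word := FpWord { fp_seq :> seq letter ; _ : fp_reduced fp_seq }.
HB.instance Definition _ := [isSub for fp_seq].
HB.instance Definition _ := [Countable of fp_word by <:].

Definition fp_nil : fp_word := @FpWord [::] isT.
HB.instance Definition _ := isPointed.Build fp_word fp_nil.

Definition fp_head (al : 'I_n) (w : seq letter) : {set 'I_d} :=
  if w is (be, A) :: _ then if be == al then A else finset.set0 else finset.set0.

Definition fp_tail (al : 'I_n) (w : seq letter) : seq letter :=
  if w is (be, _) :: w' then if be == al then w' else w else [::].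

Lemma fp_put_subproof al (B : {set 'I_d}) (w : fp_word) :
  fp_reduced (if B == finset.set0 then fp_tail al w else (al, B) :: fp_tail al w).
Proof.
case: w => -[|[be A] w] /= ; rewrite /fp_reduced /=.
  by move=> _; case: ifPn => //= ->.
rewrite -andbA => /and3P[A0 aw sw]; case: ifPn => [_|B0]; case: ifPn => bal /=.
- by rewrite aw (path_sorted sw).
- by rewrite A0 aw sw.
- by rewrite B0 aw -(eqP bal) /=; case: w sw {aw}.
- by rewrite B0 A0 aw sw /= eq_sym bal.
Qed.

(* the word obtained from w by replacing its (possibly empty) al-head with B *)
Definition fp_put (al : 'I_n) (B : {set 'I_d}) (w : fp_word) : fp_word :=
  FpWord (fp_put_subproof al B w).

Lemma fp_head_put al B w : fp_head al (fp_put al B w) = B.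
Proof.
rewrite /fp_put /=; case: (eqVneq B finset.set0) => [->|_] /=; last by rewrite eqxx.
case: w => -[|[be A] w] //= /andP[_]; case: (eqVneq be al) => [->|/negPf bal] /=.
  by case: w => //= -[be' A'] w /= /andP[]; rewrite eq_sym => /negPf ->.
by rewrite bal.
Qed.

Lemma fp_put_head al (w : fp_word) : fp_put al (fp_head al w) w = w.
Proof.
apply: val_inj => /=; case: w => -[|[be A] w] /=; first by rewrite eqxx.
rewrite /fp_reduced /= -andbA => /and3P[A0 _ _].
by case: (eqVneq be al) => [->|_]; rewrite ?(negPf A0) ?eqxx.
Qed.

Lemma fp_tail_put al B w : fp_tail al (fp_put al B w) = fp_tail al w.
Proof.
rewrite /fp_put /=; case: (eqVneq B finset.set0) => [_|_] /=; last by rewrite eqxx.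
case: w => -[|[be A] w] //= /andP[_]; case: (eqVneq be al) => [->|/negPf bal] /=.
  by case: w => //= -[be' A'] w /= /andP[]; rewrite eq_sym => /negPf ->.
by rewrite bal.
Qed.

Lemma fp_put_put al B B' w : fp_put al B (fp_put al B' w) = fp_put al B w.
Proof. by apply: val_inj; rewrite /= -[in RHS](fp_tail_put al B' w). Qed.

End FpWords.

Section FreeProduct.
Context {R : realType} {n d : nat}.
Local Notation C := R[i]^o.
(* C(R^d) is the case e = -1 on {1, ..., d} of spin_alg *)
Local Notation cliff := (spin_alg (clifford_sign R 'I_d)).

(* the matrix coefficients <a x_B, x_A> in L^2(C(R^d)) *)
Definition cliff_coef (a : cliff) (A B : {set 'I_d}) : R[i] :=
  spin_tau (spin_adj (spin_mon _ A) * a * spin_mon _ B).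

Definition fp_lact_fun (al : 'I_n) (a : cliff) (f : fp_word n d -> C) :
    fp_word n d -> C :=
  fun w => \sum_(B : {set 'I_d}) cliff_coef a (fp_head al w) B * f (fp_put al B w).

Definition l2bounded (G : (fp_word n d -> C) -> (fp_word n d -> C)) :=
  exists2 K : R, 0 <= K & forall f, (l2sq (G f) <= K%:E * l2sq f)%E.

Lemma l2bounded_sum (J : Type) (r : seq J) (G : J -> (fp_word n d -> C) -> (fp_word n d -> C)) :
  (forall j, l2bounded (G j)) -> l2bounded (fun f => \sum_(j <- r) G j f).
Proof.
move=> bG; elim: r => [|j r [K K0 IH]].
  exists 0 => // f; rewrite big_nil mul0e /l2sq esum1 // => w _.
  by rewrite /csqnorm /= !expr0n /= addr0.
have [L L0 bL] := bG j; exists (2 * (L + K)); first by rewrite mulr_ge0 ?addr_ge0.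
move=> f; rewrite big_cons; apply: le_trans (l2sqD _ _) _.
rewrite EFinM -muleA; apply: lee_wpmul2l; first by rewrite lee_fin.
by rewrite EFinD ge0_muleDl ?lee_fin //; apply: leeD.
Qed.

Lemma l2bounded_put al (c : R[i]) (A B : {set 'I_d}) :
  l2bounded (fun f (w : fp_word n d) => if fp_head al w == A then c * f (fp_put al B w) else 0).
Proof.
exists (csqnorm c); first exact: csqnorm_ge0.
move=> f; pose P := [set w : fp_word n d | fp_head al w == A].
pose g w := if w \in P then csqnorm (f (fp_put al B w)) else 0.
have g0 w : 0 <= g w by rewrite /g; case: ifP => // _; exact: csqnorm_ge0.
apply: (@le_trans _ _ ((csqnorm c)%:E * \esum_(w in [set: fp_word n d]) (g w)%:E)%E).
  apply: le_trans (esumZ (csqnorm_ge0 c) g0).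
  apply: le_esum => w _; rewrite lee_fin /g.
  have -> : (w \in P) = (fp_head al w == A) by apply/idP/idP => [/set_mem|/mem_set].
  by case: ifP => _; rewrite -?csqnormM // /csqnorm /= !expr0n /= addr0 mulr0.
apply: lee_wpmul2l; first by rewrite lee_fin csqnorm_ge0.
have -> : \esum_(w in [set: fp_word n d]) (g w)%:E =
    \esum_(w in P) (csqnorm (f (fp_put al B w)))%:E.
  by rewrite [RHS]esum_mkcond; apply: eq_esum => w _; rewrite /g; case: ifP.
rewrite -(@esum_image _ _ _ P (fp_put al B) (fun w => (csqnorm (f w))%:E)).
  rewrite esum_mkcond; apply: le_esum => w _; case: ifP => // _.
  by rewrite lee_fin csqnorm_ge0.
move=> u v /set_mem/eqP uA /set_mem/eqP vA E.
by rewrite -(fp_put_head al u) -(fp_put_head al v) uA vA -(fp_put_put al A B u) E fp_put_put.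
Qed.

Lemma l2bounded_lact al a : l2bounded (fp_lact_fun al a).
Proof.
pose G (AB : {set 'I_d} * {set 'I_d}) := fun (f : fp_word n d -> C) (w : fp_word n d) =>
  if fp_head al w == AB.1 then cliff_coef a AB.1 AB.2 * f (fp_put al AB.2 w) else 0 : C.
have [K K0 bK] := @l2bounded_sum _ (index_enum _) G (fun _ => l2bounded_put _ _ _ _).
exists K => // f; apply: le_trans (bK f); apply: le_esum => w _.
suff -> : fp_lact_fun al a f w = (\sum_(AB <- index_enum _) G AB f) w by [].
rewrite fct_sumE -(pair_bigA _ (fun A B => G (A, B) f w)) /= /G /=.
rewrite [RHS](bigD1 (fp_head al w)) //= [X in _ = _ + X]big1 ?addr0.
  by rewrite /fp_lact_fun; apply: eq_bigr => B _; rewrite eqxx.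
by move=> A /negPf; rewrite eq_sym => ->; rewrite big1.
Qed.

Lemma fp_lact_subproof al a (f : ell2 R (fp_word n d)) :
  square_summable (fp_lact_fun al a f).
Proof.
have [K K0 bK] := l2bounded_lact al a; apply/asboolP; apply: le_lt_trans (bK f) _.
have ff : l2sq f \is a fin_num by rewrite ge0_fin_numE ?l2sq_ge0 ?ell2P.
by rewrite -(fineK ff) -EFinM ltry.
Qed.

(* lambda_al(a): the action of a on the left tensor factor of
   L^2(M) = L^2(C(R^d)) (x) l^2(words not starting with al), where (A, w) stands
   for the word (al, A) w, and for w itself when A is empty *)
Definition fp_lact (al : 'I_n) (a : cliff) (f : ell2 R (fp_word n d)) :
  ell2 R (fp_word n d) := Ell2 (fp_lact_subproof al a f).

Definition fp_left : set (ell2 R (fp_word n d) -> ell2 R (fp_word n d)) :=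
  [set T | exists al a, T = fp_lact al a].

Lemma fp_lact_bounded al a : bounded_linear (fp_lact al a).
Proof.
split=> [x f g|]; last by have [K _ bK] := l2bounded_lact al a; exists K => f; exact: bK.
apply/val_inj/funext => w.
rewrite -[LHS]/(fp_lact_fun al a (x *: (f : _ -> C) + (g : _ -> C)) w).
rewrite -[RHS]/(x * fp_lact_fun al a f w + fp_lact_fun al a g w).
rewrite /fp_lact_fun mulr_sumr -big_split; apply: eq_bigr => B _ /=.
by rewrite mulrDr mulrCA.
Qed.

(* The reduced free product von Neumann algebra. Each lambda_al is a
   *-representation, so fp_left is self-adjoint and its bicommutant is the von
   Neumann algebra that it generates. *)
Definition fp_alg : Type := vN_alg fp_left.
HB.instance Definition _ := GRing.Algebra.on fp_alg.

Lemma fp_emb_subproof al a : bicommutant fp_left (fp_lact al a).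
Proof.
apply/asboolP; split=> [|U [_ cU]]; first exact: fp_lact_bounded.
by rewrite cU //; exists al, a.
Qed.

Definition fp_emb (al : 'I_n) (a : cliff) : fp_alg := VNAlg (fp_emb_subproof al a).

(* the vacuum state *)
Definition fp_tau (T : fp_alg) : R[i] := vN_state (fp_nil n d) T.

Lemma cliff_coefM (a b : cliff) A B :
  cliff_coef (a * b) A B = \sum_(D : {set 'I_d}) cliff_coef a A D * cliff_coef b D B.
Proof.
rewrite /cliff_coef -!mulrA {1}[b * _]spin_fourier !mulr_sumr linear_sum.
apply: eq_bigr => D _.
by rewrite -!scalerAr linearZ /= mulrC !mulrA.
Qed.

Lemma fp_embM al (a b : cliff) : fp_emb al (a * b) = fp_emb al a * fp_emb al b.
Proof.
apply/val_inj/funext => f; apply/val_inj/funext => w.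
rewrite -[LHS]/(fp_lact_fun al (a * b) f w).
rewrite -[RHS]/(fp_lact_fun al a (fp_lact_fun al b f) w).
rewrite /fp_lact_fun; under eq_bigr do rewrite cliff_coefM mulr_suml.
rewrite exchange_big; apply: eq_bigr => D _; rewrite mulr_sumr.
by apply: eq_bigr => B _; rewrite fp_head_put fp_put_put mulrA.
Qed.

Lemma fp_emb1 al : fp_emb al 1 = 1.
Proof.
apply/val_inj/funext => f; apply/val_inj/funext => w.
rewrite -[LHS]/(fp_lact_fun al 1 f w) -[RHS]/(f w).
rewrite /fp_lact_fun (bigD1 (fp_head al w)) //= /cliff_coef mulr1.
rewrite spin_mon_orthonormal eqxx mul1r fp_put_head big1 ?addr0 // => B.
by move=> /negPf Bw; rewrite spin_mon_orthonormal eq_sym Bw mul0r.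
Qed.

Lemma fp_tau_emb al a : fp_tau (fp_emb al a) = spin_tau a.
Proof.
rewrite -[LHS]/(fp_lact_fun al a (ell2_delta (fp_nil n d)) (fp_nil n d)).
have dE w : ell2_delta (fp_nil n d) w = (w == fp_nil n d)%:R :> R[i] by [].
have pE B : (fp_put al B (fp_nil n d) == fp_nil n d) = (B == finset.set0).
  apply/eqP/eqP => [/(congr1 val) /=|->]; first by case: eqP.
  by apply: val_inj; rewrite /= eqxx.
rewrite /fp_lact_fun; under eq_bigr do rewrite dE pE.
rewrite (bigD1 finset.set0) //= big1 ?addr0 => [|B /negPf ->]; last by rewrite mulr0.
rewrite eqxx mulr1 /cliff_coef.
by rewrite /spin_mon enum_set0 /= !big_nil spin_adj1 mul1r mulr1.
Qed.

(* the generator x_i of the copy of C(R^d) with index al *)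
Definition fp_gen (al : 'I_n) (i : 'I_d) : fp_alg := fp_emb al (spin_gen _ i).

End FreeProduct.
(* Indices are 0-based: k : nat stands for the index k + 1 >= 1. *)
Definition Ups (n d : nat) : Type := ('I_n *l 'I_d *l nat)%type.
HB.instance Definition _ n d := Order.Total.on (Ups n d).

Definition Ups_upto (n d m : nat) : Type := ('I_n *l 'I_d *l 'I_m)%type.
HB.instance Definition _ n d m := Order.FinTotal.on (Ups_upto n d m).

Definition Ups_incl (n d m : nat) (p : Ups_upto n d m) : Ups n d :=
  (p.1.1, p.1.2, nat_of_ord p.2).

Definition mutually_independent (R : realType) (dT : measure_display)
    (T : measurableType dT) (P : probability T R) (J : choiceType) (D : set J)
    (X : J -> T -> R) : Prop :=
  forall (F : seq J) (B : J -> set R),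
    uniq F -> (forall j, j \in F -> D j) -> (forall j, measurable (B j)) ->
    P (\big[setI/setT]_(j <- F) (X j @^-1` B j)) =
    (\prod_(j <- F) P (X j @^-1` B j))%E.

Record spin_model (R : realType) (dT : measure_display) (T : measurableType dT)
    (P : probability T R) (n d : nat) (eps : T -> signfun R (Ups n d)) : Prop := {
  spin_model_measurable : forall p q : Ups n d, (p < q)%O ->
    measurable_fun setT (fun w => eps w p q) ;
  spin_model_independent :
    mutually_independent P [set pq : Ups n d * Ups n d | (pq.1 < pq.2)%O]
      (fun pq w => eps w pq.1 pq.2) ;
  spin_model_law : forall p q : Ups n d, (p < q)%O ->
    P [set w | eps w p q = -1] = (if p.1.1 == q.1.1 then 1 else 2^-1)%:E }.

Definition spin_upto (R : realType) (n d : nat) (e : signfun R (Ups n d)) (m : nat) :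
  signfun R (Ups_upto n d m) := signfun_comp (@Ups_incl n d m) e.

Definition xtilde (R : realType) (n d : nat) (e : signfun R (Ups n d)) (m : nat)
    (al : 'I_n) (i : 'I_d) : spin_alg (spin_upto e m) :=
  ((Num.sqrt m%:R)^-1)%:C *: \sum_(k < m) spin_gen (spin_upto e m) (al, i, k).

(* Main.v *)
Require Import Defs.
From HB Require Import structures.
From mathcomp Require Import all_boot all_order all_algebra.
From mathcomp Require Import complex zify ring lra.
From mathcomp Require Import all_classical all_reals all_analysis measurable_realfun.
Set Implicit Arguments.
Unset Strict Implicit.
Unset Printing Implicit Defensive.
Import Order.TTheory GRing.Theory Num.Theory.
Import numFieldNormedType.Exports.

(** For almost every omega and all m >= 1 the averages x~_i^alpha(m) satisfy, for
    each alpha, exactly the Clifford relations, as do the generators of the free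
    product. Hence a word whose two equal letters are separated only by letters
    with the same alpha can be shortened on both sides with the same sign, and it
    suffices to treat words without such a pair ("color-reduced" words). For a
    nonempty one the free trace vanishes. On the spin side, tau(x_p1 ... x_ps) is
    the product of the signs eps(p_a, p_b) over a < b with p_a < p_b when every
    letter has even multiplicity, and 0 otherwise. Expanding the square of the
    moment, a pair of words contributes to the expectation only if it has at most
    s - 2 distinct letters: otherwise one of the two words is a pairing, which by
    reducedness has a crossing of different colors (values of alpha), and the sign
    of that crossing occurs to an odd power. So the second moment is O(m^-2), which
    is summable. *)

(** * Crossings in words *)

(** Quantified over all pairs of equal letters, consecutive occurrences or not; the negation hands
    over exactly a pair of letters that [anticommuting_cancel] removes. *)
Definition color_reduced (T A : eqType) (c : T -> A) (w : seq T) : Prop :=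
  forall w1 x w2 w3, w = w1 ++ x :: w2 ++ x :: w3 ->
    has (fun y => c y != c x) w2.

Lemma color_reduced_map (T U A : eqType) (c : T -> A) (f : U -> T) (w : seq U) :
  color_reduced c (map f w) -> color_reduced (c \o f) w.
Proof.
move=> cr w1 x w2 w3 E.
have := cr (map f w1) (f x) (map f w2) (map f w3).
by rewrite E !(map_cat, map_cons) has_map; apply.
Qed.

Definition even_word (T : eqType) (w : seq T) : bool :=
  all (fun p => ~~ odd (count_mem p w)) w.

Lemma even_wordP (T : eqType) (w : seq T) :
  reflect (forall p, ~~ odd (count_mem p w)) (even_word w).
Proof.
apply: (iffP allP) => [ew p|ew p _]; last exact: ew.
have [/ew//|/count_memPn -> //] := boolP (p \in w).
Qed.

Lemma even_word_map (T U : eqType) (f : T -> U) (w : seq T) :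
  injective f -> even_word (map f w) = even_word w.
Proof.
move=> fI; rewrite /even_word all_map; apply: eq_all => p /=.
by rewrite count_map; congr (~~ odd _); apply: eq_count => q /=; rewrite inj_eq.
Qed.

Lemma size_sum_count (T : eqType) (w : seq T) :
  size w = \sum_(p <- undup w) count_mem p w.
Proof.
rewrite -[LHS]sum1_size -big_undup_iterop_count.
apply: eq_bigr => p _; case: (count_mem p w) => // k.
by rewrite iteropS iter_addn mul1n addn1.
Qed.

(** Every letter of an even word occurs at least twice, so the truncated [count_mem p w - 2] is the
    true excess over a pairing. *)
Lemma size_even_word (T : eqType) (w : seq T) : even_word w ->
  size w = 2 * size (undup w) + \sum_(p <- undup w) (count_mem p w - 2).
Proof.
move=> /even_wordP ew; rewrite [LHS]size_sum_count mulnC -sum1_size big_distrl -big_split /=.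
rewrite !big_seq; apply: eq_bigr => p; rewrite mem_undup mul1n => pw.
have : 0 < count_mem p w by rewrite -has_count has_pred1.
by have := ew p; lia.
Qed.

Lemma double_size_undup (T : eqType) (w : seq T) :
  even_word w -> 2 * size (undup w) <= size w.
Proof. by move=> /size_even_word ->; exact: leq_addr. Qed.

(** The total excess over a pairing is below 2, while the excess of each letter is even. *)
Lemma count_even_word (T : eqType) (w : seq T) p : even_word w ->
  size w < 2 * size (undup w) + 2 -> p \in w -> count_mem p w = 2.
Proof.
move=> ew; rewrite (size_even_word ew) ltn_add2l => lt2 pw.
have : count_mem p w - 2 <= \sum_(q <- undup w) (count_mem q w - 2).
  by rewrite (big_rem p) ?mem_undup //= leq_addr.
have : 0 < count_mem p w by rewrite -has_count has_pred1.
by have /even_wordP/(_ p) := ew; lia.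
Qed.

Section Pairs.
Context {disp : Order.disp_t} {U : porderType disp}.

(** Only increasing pairs are kept, since these index the independent random signs; repetitions are
    kept because the parity of each sign matters. *)
Fixpoint ordered_pairs (w : seq U) : seq (U * U) :=
  if w is p :: w' then [seq (p, q) | q <- w' & (p < q)%O] ++ ordered_pairs w'
  else [::].

Lemma ordered_pairs_lt w pq : pq \in ordered_pairs w -> (pq.1 < pq.2)%O.
Proof.
elim: w => //= p w IH; rewrite mem_cat => /orP[/mapP[q]|/IH//].
by rewrite mem_filter => /andP[lt _] ->.
Qed.

Lemma mem_ordered_pairs w p q : (p, q) \in ordered_pairs w -> p \in w /\ q \in w.
Proof.
elim: w => //= r w IH; rewrite mem_cat !inE => /orP[/mapP[q']|/IH[-> ->]]; last first.
  by rewrite !orbT.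
by rewrite mem_filter => /andP[_ qw] [-> ->]; rewrite eqxx qw orbT.
Qed.

Lemma count_ordered_pairs_cons p q r w : (p < q)%O ->
  count_mem (p, q) (ordered_pairs (r :: w)) =
  (r == p) * count_mem q w + count_mem (p, q) (ordered_pairs w).
Proof.
move=> pq /=; rewrite count_cat count_map count_filter; congr (_ + _).
have [->|rp] := eqVneq r p.
  rewrite mul1n; apply: eq_count => q' /=; rewrite xpair_eqE eqxx /=.
  by have [->|] := eqVneq q' q.
rewrite mul0n; apply/eqP; rewrite -leqn0 leqNgt -has_count -all_predC.
by apply/allP => q' _; rewrite /= xpair_eqE (negPf rp).
Qed.

Lemma count_ordered_pairs_cat p q w w' : (p < q)%O ->
  count_mem (p, q) (ordered_pairs (w ++ w')) =
  count_mem (p, q) (ordered_pairs w) + count_mem p w * count_mem q w' +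
  count_mem (p, q) (ordered_pairs w').
Proof.
move=> pq; elim: w => [|r w IH]; first by rewrite mul0n.
rewrite cat_cons.
by rewrite !count_ordered_pairs_cons // IH count_cat /= mulnDr mulnDl !addnA
  (addnAC _ _ (count_mem _ (ordered_pairs w))).
Qed.

Lemma count_ordered_pairs_notin p q w : (p \notin w) || (q \notin w) ->
  count_mem (p, q) (ordered_pairs w) = 0.
Proof.
move=> pqw; apply/count_memPn; apply: contraTN pqw => /mem_ordered_pairs[-> ->].
by [].
Qed.

(* An innermost pair of equal letters encloses, by reducedness, a letter of
   another color, whose partner then lies outside. *)
Lemma crossing_exists (A : eqType) (c : U -> A) (w : seq U) :
  color_reduced c w -> w != [::] -> {in w, forall p, count_mem p w = 2} ->
  exists w1 p w2 q w3, [/\ w = w1 ++ p :: w2 ++ p :: w3, c q != c p & count_mem q w2 = 1].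
Proof.
move=> cr w0 c2.
(* Descent on the length of the factor between two equal letters: a letter of another color inside
   occurs there once, which is the crossing, or twice, which encloses a shorter factor. *)
suff H k : forall w1 p w2 w3, size w2 < k -> w = w1 ++ p :: w2 ++ p :: w3 ->
    exists w1 p w2 q w3,
      [/\ w = w1 ++ p :: w2 ++ p :: w3, c q != c p & count_mem q w2 = 1].
  case: w w0 c2 H {cr} => // p w _ c2 H.
  have := c2 p (mem_head _ _); rewrite /= eqxx add1n => -[cp].
  have pw : p \in w by rewrite -has_pred1 has_count cp.
  case/splitPr: pw H => w2 w3 /(_ (size w2).+1 [::] p w2 w3 (ltnSn _)); exact.
elim: k => // k IH w1 p w2 w3 sk E.
have /hasP[q q2 cq] := cr _ _ _ _ E.
have qp : (p == q) = false by apply: contraNF cq => /eqP ->.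
have cqw : count_mem q w = 2 by apply: c2; rewrite E !(mem_cat, inE) q2 !orbT.
have [c1|n1] := eqVneq (count_mem q w2) 1; first by exists w1, p, w2, q, w3.
have c0 : 0 < count_mem q w2 by rewrite -has_count has_pred1.
rewrite [in count_mem q w]E count_cat /= count_cat /= qp !add0n in cqw.
have c2' : count_mem q w2 = 2.
  by move: (count_mem q w1) (count_mem q w2) (count_mem q w3) n1 c0 cqw; lia.
move: sk E; case/splitPr: q2 c2' {c0 n1 cqw cq} => v1 v2.
rewrite count_cat /= eqxx => cv sk E.
have qv : (q \in v1) || (q \in v2).
  by rewrite -!has_pred1 !has_count; move: (count_mem q v1) (count_mem q v2) cv; lia.
case/orP: qv E sk => /splitPr[u1 u2] E sk.
- apply: (IH (w1 ++ p :: u1) q u2 (v2 ++ p :: w3)).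
    by move: sk; rewrite !size_cat /= ?size_cat /=; lia.
  by rewrite E -?catA /= -?catA /= -?catA /= -?catA.
- apply: (IH (w1 ++ p :: v1) q u1 (u2 ++ p :: w3)).
    by move: sk; rewrite !size_cat /= ?size_cat /=; lia.
  by rewrite E -?catA /= -?catA /= -?catA /= -?catA.
Qed.

(** If [q] occurs b times after the second [p], then [p] precedes [q] at 1 + 2b pairs of positions;
    occurrences before the first [p] are counted likewise for the other order. *)
Lemma odd_crossing w1 p w2 w3 q (w := w1 ++ p :: w2 ++ p :: w3) :
  p != q -> count_mem p w = 2 -> count_mem q w = 2 -> count_mem q w2 = 1 ->
  ((p < q)%O -> odd (count_mem (p, q) (ordered_pairs w))) /\
  ((q < p)%O -> odd (count_mem (q, p) (ordered_pairs w))).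
Proof.
move=> pq; rewrite {}/w !count_cat /= !count_cat /= !eqxx (negPf pq) => cp cq c1.
have [p1 p2 p3] : [/\ count_mem p w1 = 0, count_mem p w2 = 0 & count_mem p w3 = 0].
  by move: (count_mem p w1) (count_mem p w2) (count_mem p w3) cp; split; lia.
have Z w4 : count_mem p w4 = 0 ->
    count_mem (p, q) (ordered_pairs w4) = 0 /\ count_mem (q, p) (ordered_pairs w4) = 0.
  by move/count_memPn => pw; rewrite !count_ordered_pairs_notin ?pw ?orbT.
have [[Z1 Z1'] [Z2 Z2'] [Z3 Z3']] := And3 (Z _ p1) (Z _ p2) (Z _ p3).
split=> lt; rewrite !(count_ordered_pairs_cat, count_ordered_pairs_cons) //.
  rewrite Z1 Z2 Z3 p1 p2 !count_cat /= (negPf pq) c1 eqxx.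
  by rewrite !mul0n !add0n !mul1n addn0 -addnA oddD addnn odd_double.
rewrite Z1' Z2' Z3' !count_cat /= !count_cat /= (negPf pq) p3 p2 eqxx c1.
rewrite -[nat_of_bool true]/1 -[nat_of_bool false]/0 !mul0n !add0n !addn0.
by rewrite (addn1 1) muln2 addn1 /= odd_double.
Qed.
End Pairs.

Lemma size_undup_catI (T : eqType) (w v : seq T) p q : p != q ->
  p \in w -> q \in w -> p \in v -> q \in v ->
  size (undup (w ++ v)) + 2 <= size (undup w) + size (undup v).
Proof.
move=> pq pw qw pv qv; rewrite undup_cat size_cat.
have : size [:: p; q] <= size [seq x <- undup w | x \in v].
  apply: uniq_leq_size; first by rewrite /= inE pq.
  by move=> x; rewrite !inE mem_filter mem_undup => /orP[]/eqP ->; rewrite ?pw ?pv ?qw ?qv.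
have := count_predC (mem v) (undup w); rewrite -!size_filter /=.
rewrite (@eq_filter _ (mem v) (fun x => x \in v)) //.
rewrite (@eq_filter _ (predC (mem v)) (fun x => x \notin v)) //; lia.
Qed.

(* If many letters are distinct then one of the two words is a pairing and they
   share at most one letter, so that the sign of a crossing of that pairing
   occurs an odd number of times in total. *)
Lemma odd_pair_exists (disp : Order.disp_t) (U : orderType disp) (A : eqType)
    (c : U -> A) (w v : seq U) :
  color_reduced c w -> color_reduced c v -> even_word w -> even_word v ->
  size v = size w -> size w < size (undup (w ++ v)) + 2 -> 0 < size w ->
  exists p q, [/\ (p < q)%O, c p != c q &
    odd (count_mem (p, q) (ordered_pairs w ++ ordered_pairs v))].
Proof.
(* If both words exceeded twice their numbers of distinct letters by at least 2, adding the bounds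
   would leave at most [size w - 2] distinct letters in [w ++ v]. By symmetry [w] is a word without
   such an excess. *)
wlog : w v / size w < 2 * size (undup w) + 2.
  move=> H cw cv ew ev sE lt s0.
  have [lw|lw] := ltnP (size w) (2 * size (undup w) + 2); first exact: H.
  have uC : size (undup (v ++ w)) = size (undup (w ++ v)).
    apply: perm_size; apply: uniq_perm; rewrite ?undup_uniq // => x.
    by rewrite !mem_undup !mem_cat orbC.
  have [|||p [q [pq cpq od]]] := H v w _ cv cw ev ew (esym sE).
  - have : size (undup (w ++ v)) <= size (undup w) + size (undup v).
      by rewrite undup_cat size_cat leq_add2r size_filter count_size.
    by rewrite sE; lia.
  - by rewrite uC sE.
  - by rewrite sE.
  by exists p, q; split=> //; move: od; rewrite !count_cat addnC.
move=> lw cw cv ew ev sE lt s0.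
have c2 : {in w, forall p, count_mem p w = 2} by move=> p; exact: count_even_word.
have w0 : w != [::] by rewrite -size_eq0 -lt0n.
have [w1 [p [w2 [q [w3 [E cqp c1]]]]]] := crossing_exists cw w0 c2.
have pw : p \in w by rewrite E !(mem_cat, inE) eqxx !orbT.
have qw : q \in w.
  by rewrite E mem_cat inE mem_cat -(has_pred1 q w2) has_count c1 !orbT.
have pq : p != q by apply: contraNneq cqp => ->.
(* Sharing both letters would again force at most [size w - 2] distinct letters; hence [v] adds
   nothing to the count of this pair. *)
have F : ~~ ((p \in v) && (q \in v)).
  apply/negP => /andP[pv qv].
  have := size_undup_catI pq pw qw pv qv.
  have := double_size_undup ew; have := double_size_undup ev; move: lt sE.
  move: (size (undup (w ++ v))) (size (undup w)) (size (undup v)); move: (size v) (size w); lia.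
have : ((p < q)%O -> odd (count_mem (p, q) (ordered_pairs w))) /\
  ((q < p)%O -> odd (count_mem (q, p) (ordered_pairs w))).
  by rewrite E; apply: odd_crossing => //; rewrite -E c2.
move=> [odd_pq odd_qp].
have [lpq|lqp|/eqP] := ltgtP p q; last by rewrite (negPf pq).
- exists p, q; split=> //; first by rewrite eq_sym.
  by rewrite count_cat (@count_ordered_pairs_notin _ _ _ _ v) -?negb_and // addn0 odd_pq.
- exists q, p; split=> //.
  by rewrite count_cat (@count_ordered_pairs_notin _ _ _ _ v) -?negb_and 1?andbC // addn0 odd_qp.
Qed.

Local Open Scope classical_set_scope.
Local Open Scope ring_scope.
Local Open Scope complex_scope.

(** * Moments in spin algebras *)

Definition word_sign (R : realType) (disp : Order.disp_t) (U : porderType disp)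
    (e : U -> U -> R) (w : seq U) : R :=
  \prod_(pq <- ordered_pairs w) e pq.1 pq.2.

Lemma word_sign_cons (R : realType) (disp : Order.disp_t) (U : porderType disp)
    (e : U -> U -> R) p (w : seq U) :
  word_sign e (p :: w) = (\prod_(q <- w) if (p < q)%O then e p q else 1) * word_sign e w.
Proof. by rewrite /word_sign /= big_cat /= big_map big_filter big_mkcond. Qed.

Lemma word_sign_comp (R : realType) (d1 d2 : Order.disp_t)
    (U : porderType d1) (V : porderType d2) (h : U -> V)
    (e : V -> V -> R) (w : seq U) : {mono h : p q / (p < q)%O} ->
  word_sign (fun p q => e (h p) (h q)) w = word_sign e (map h w).
Proof.
move=> hm; elim: w => [|p w IH]; first by rewrite /word_sign /= !big_nil.
by rewrite map_cons !word_sign_cons IH big_map; under [in RHS]eq_bigr do rewrite hm.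
Qed.

Section SpinWords.
Context {R : realType} {disp : Order.disp_t} {I : finOrderType disp} (e : signfun R I).
Local Notation N := #|{set I}|.

(** Each generator is a signed permutation matrix, so row [a] has one nonzero entry. Evaluating the
    sign of a letter on [a] instead of on the toggled set costs one factor for each earlier smaller
    letter; [word_sign] collects these factors. *)
Lemma spin_lrep_word (w : seq I) (a c : 'I_N) :
  spin_lrep (\prod_(p <- w) spin_gen e p) a c =
  ((\prod_(p <- w) spin_sgn e p a) * word_sign e w)%:C
    *+ (c == foldl (fun b p => spin_flip p b) a w).
Proof.
elim: w a => [|p w IH] a /=.
  by rewrite !big_nil /word_sign /= big_nil mul1r spin_lrep1 mxE eq_sym.
rewrite !big_cons spin_lrepM spin_lrep_gen spin_lgen_mul IH mulrnAr -rmorphM /=.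
congr (_ *+ _); congr (_ %:C).
rewrite word_sign_cons -[RHS]mulrA; congr (_ * _); rewrite [RHS]mulrA; congr (_ * _).
rewrite -big_split /=; apply: eq_bigr => q _.
by rewrite spin_sgn_flip mulrC (signfunC e q p).
Qed.

(** The diagonal entry at the empty set is a linear functional with the same values on the basis
    [spin_mon], so a single entry replaces the normalized trace. *)
Lemma spin_tau_lrep (u : spin_alg e) :
  spin_tau u = spin_lrep u (enum_rank finset.set0) (enum_rank finset.set0).
Proof.
apply/esym; move: u; apply: spin_tau_unique => [x u v|A].
  by rewrite spin_lrepD spin_lrepZ !mxE.
have [->|A0] := eqVneq A finset.set0.
  by rewrite /spin_mon enum_set0 /= big_nil spin_lrep1 mxE eqxx.
apply/eqP; apply: contraNT A0 => /spin_lmonE -/(_ (Order.enum_uniq _)).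
rewrite !enum_rankK => /finset.setP E; apply/eqP/finset.setP => q; move: (E q).
by rewrite !inE Order.mem_enum addbF => <-.
Qed.

Lemma mem_foldl_spin_flip (w : seq I) (a : 'I_N) q :
  (q \in enum_val (foldl (fun b p => spin_flip p b) a w)) =
  odd (count_mem q w) (+) (q \in enum_val a).
Proof.
elim: w a => //= p w IH a; rewrite IH spin_in_flip oddD oddb (eq_sym q p).
by rewrite addbA; congr (_ (+) _); rewrite addbC.
Qed.

(** Starting from the empty set, every [spin_sgn] is 1 and the toggles end at the set of letters of
    odd multiplicity. *)
Lemma spin_tau_word (w : seq I) :
  spin_tau (\prod_(p <- w) spin_gen e p) = (word_sign e w *+ even_word w)%:C.
Proof.
rewrite spin_tau_lrep spin_lrep_word big1 ?mul1r => [|p _]; last first.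
  by rewrite /spin_sgn enum_rankK big_pred0 // => q; rewrite inE.
rewrite rmorphMn /=; congr (_ *+ nat_of_bool _); apply/eqP/even_wordP => [E p|ew].
  have := mem_foldl_spin_flip w (enum_rank finset.set0) p.
  by rewrite -E !enum_rankK inE addbF => <-.
apply: enum_val_inj; apply/finset.setP => q.
by rewrite mem_foldl_spin_flip enum_rankK inE addbF (negPf (ew q)).
Qed.

Lemma spin_tau1 : spin_tau (1 : spin_alg e) = 1.
Proof.
by have := spin_tau_word [::]; rewrite big_nil /word_sign big_nil mulr1n.
Qed.

End SpinWords.

(** * Expansion of the moments of the averages *)

Lemma prod_sum_zip (A : nzRingType) (L I : finType) (X : L -> I -> A) (w : seq L) :
  \prod_(l <- w) \sum_k X l k =
  \sum_(t : (size w).-tuple I) \prod_(p <- zip w t) X p.1 p.2.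
Proof.
elim: w => [|l w IH] /=.
  rewrite big_nil (big_pred1 [tuple]) => [|t]; last by apply/esym/eqP; exact: tuple0.
  by rewrite big_nil.
rewrite big_cons IH mulr_suml.
transitivity (\sum_(kt : I * (size w).-tuple I)
    \prod_(p <- zip (l :: w) [tuple of kt.1 :: kt.2]) X p.1 p.2).
  rewrite -(pair_bigA _ (fun k (t : (size w).-tuple I) =>
    \prod_(p <- zip (l :: w) [tuple of k :: t]) X p.1 p.2)) /=.
  apply: eq_bigr => k _; rewrite mulr_sumr; apply: eq_bigr => t _.
  by rewrite big_cons.
rewrite (reindex (fun kt : I * (size w).-tuple I => [tuple of kt.1 :: kt.2])) //=.
exists (fun t : (size w).+1.-tuple I => (thead t, [tuple of behead t])).
  by move=> [k t] _ /=; rewrite theadE; congr (_, _); apply: val_inj.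
by move=> t _ /=; rewrite [RHS]tuple_eta.
Qed.

Lemma Ups_incl_lt (n d m : nat) : {mono @Ups_incl n d m : p q / (p < q)%O}.
Proof.
move=> [[a i] k] [[b j] l]; rewrite /Ups_incl /=.
by rewrite !Order.ProdLexiOrder.ltEprodlexi /=.
Qed.

Lemma Ups_incl_inj (n d m : nat) : injective (@Ups_incl n d m).
Proof. by move=> [[a i] k] [[b j] l] [-> -> /val_inj ->]. Qed.

Lemma prodrZ_const (K : comNzRingType) (A : algType K) (L : Type) (c : K) (F : L -> A)
    (w : seq L) :
  \prod_(l <- w) (c *: F l) = c ^+ size w *: \prod_(l <- w) F l.
Proof.
elim: w => [|l w IH] /=; first by rewrite !big_nil expr0 scale1r.
by rewrite !big_cons IH -scalerAl -scalerAr scalerA exprS.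
Qed.

Definition Ups_word (n d m : nat) (w : seq ('I_n * 'I_d)) (t : seq 'I_m) : seq (Ups n d) :=
  map (@Ups_incl n d m) (zip w t).

(** A real combinatorial form of the moment, free of the algebra that varies with the signs, so that
    it can be integrated over the probability space. *)
Definition spin_moment (R : realType) (n d : nat) (e : signfun R (Ups n d)) (m : nat)
    (w : seq ('I_n * 'I_d)) : R :=
  (Num.sqrt m%:R)^-1 ^+ size w *
  \sum_(t : (size w).-tuple 'I_m) word_sign e (Ups_word w t) *+ even_word (Ups_word w t).

Lemma spin_tau_xtilde (R : realType) (n d : nat) (e : signfun R (Ups n d)) (m : nat)
    (w : seq ('I_n * 'I_d)) :
  spin_tau (\prod_(l <- w) xtilde e m l.1 l.2) = (spin_moment e m w)%:C.
Proof.
rewrite /xtilde prodrZ_const linearZ /=.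
rewrite (prod_sum_zip (fun l k => spin_gen (spin_upto e m) (l.1, l.2, k))).
rewrite linear_sum /spin_moment rmorphM rmorphXn rmorph_sum; congr (_ * _).
apply: eq_bigr => t _.
have -> : \prod_(p <- zip w t) spin_gen (spin_upto e m) (p.1.1, p.1.2, p.2) =
    \prod_(p <- (zip w t : seq (Ups_upto n d m))) spin_gen (spin_upto e m) p.
  by apply: eq_bigr => -[[a i] k].
apply: etrans (spin_tau_word (spin_upto e m) (zip w t : seq (Ups_upto n d m))) _.
rewrite -word_sign_comp; last exact: Ups_incl_lt.
by rewrite (even_word_map _ (@Ups_incl_inj n d m)).
Qed.

(** In the double sums the terms with distinct third indices cancel, and the m diagonal terms are
    compensated by the square of the normalization. At m = 0 the average is zero, whence the
    hypothesis [0 < m]. *)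
Lemma xtilde_anticomm (R : realType) (n d : nat) (e : signfun R (Ups n d)) (m : nat)
    (al : 'I_n) (i j : 'I_d) :
  (forall p q : Ups n d, p.1.1 = q.1.1 -> e p q = -1) -> (0 < m)%N ->
  xtilde e m al i * xtilde e m al j + xtilde e m al j * xtilde e m al i =
  (2 * (i == j)%:R)%:A.
Proof.
move=> eN m0; rewrite /xtilde -!scalerAl -!scalerAr !scalerA -scalerDr.
set X := fun i k => spin_gen (spin_upto e m) (al, i, k).
have sE i' j' : (\sum_(k < m) X i' k) * (\sum_(k < m) X j' k) =
    \sum_(k < m) \sum_(l < m) X i' k * X j' l.
  by rewrite mulr_suml; apply: eq_bigr => k _; rewrite mulr_sumr.
rewrite !sE [X in _ *: (_ + X)]exchange_big -big_split /=.
have relX k l : X i k * X j l + X j l * X i k = (2 * ((i == j) && (k == l))%:R)%:A.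
  have := spin_gen_comm (spin_upto e m) (al, i, k) (al, j, l).
  rewrite /= eN //= rmorphN1 scaleN1r opprK => ->; congr ((2 * _%:R) *: _).
  by rewrite /eq_op /= /eq_op /= eqxx.
under eq_bigr => k _ do (rewrite -big_split /=; under eq_bigr do rewrite relX).
have -> : \sum_(k < m) \sum_(l < m) (2 * ((i == j) && (k == l))%:R)%:A
    = m%:R *: ((2 * (i == j)%:R)%:A : spin_alg (spin_upto e m)).
  transitivity (\sum_(k < m) (2 * (i == j)%:R)%:A : spin_alg (spin_upto e m)).
    apply: eq_bigr => k _; rewrite (bigD1 k) //= eqxx andbT big1 ?addr0 // => l.
    by rewrite eq_sym => /negPf ->; rewrite andbF mulr0 scale0r.
  by rewrite sumr_const card_ord scaler_nat.
rewrite !scalerA; congr (_ *: _); rewrite -[RHS]mul1r; congr (_ * _).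
have mp : 0 < m%:R :> R by rewrite ltr0n.
rewrite -rmorphM -(rmorph_nat (real_complex R)) -rmorphM /= -invfM -expr2 sqr_sqrtr ?ltW //.
by rewrite mulVf ?gt_eqF.
Qed.

(** * Second moments in the random spin model *)

Section BoundedMeasurable.
Context {R : realType} {dT : measure_display} {T : measurableType dT} (P : probability T R).

(** A class stable under sums and products and integrable for [P]; it contains every polynomial in
    the signs and in indicators of events. *)
Definition bounded_mfun (f : T -> R) : Prop :=
  measurable_fun setT f /\ exists C : R, forall w, `|f w| <= C.

Lemma bounded_mfun_cst (c : R) : bounded_mfun (fun _ => c).
Proof. by split; [exact: measurable_cst|exists `|c|]. Qed.

Lemma bounded_mfunD f g : bounded_mfun f -> bounded_mfun g ->
  bounded_mfun (fun w => f w + g w).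
Proof.
move=> [mf [C fC]] [mg [D gD]]; split; first exact: measurable_funD.
by exists (C + D) => w; apply: le_trans (ler_normD _ _) (lerD _ _).
Qed.

Lemma bounded_mfunM f g : bounded_mfun f -> bounded_mfun g ->
  bounded_mfun (fun w => f w * g w).
Proof.
move=> [mf [C fC]] [mg [D gD]]; split; first exact: measurable_funM.
by exists (C * D) => w; rewrite normrM ler_pM.
Qed.

Lemma bounded_mfun_prod (J : eqType) (s : seq J) (F : J -> T -> R) :
  {in s, forall j, bounded_mfun (F j)} -> bounded_mfun (fun w => \prod_(j <- s) F j w).
Proof.
elim: s => [|j s IH] bF.
  by under eq_fun do rewrite big_nil; exact: bounded_mfun_cst.
under eq_fun do rewrite big_cons; apply: bounded_mfunM; first exact/bF/mem_head.
by apply: IH => k ks; apply: bF; rewrite inE ks orbT.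
Qed.

Lemma bounded_mfun_sum (J : Type) (s : seq J) (F : J -> T -> R) :
  (forall j, bounded_mfun (F j)) -> bounded_mfun (fun w => \sum_(j <- s) F j w).
Proof.
move=> bF; elim: s => [|j s IH].
  by under eq_fun do rewrite big_nil; exact: bounded_mfun_cst.
by under eq_fun do rewrite big_cons; apply: bounded_mfunD.
Qed.

Lemma bounded_mfun_indic (D : set T) : measurable D -> bounded_mfun (\1_D : T -> R).
Proof.
move=> mD; split; first exact: measurable_indic.
by exists 1 => w; rewrite indicE; case: (_ \in _); rewrite ?normr1 ?normr0.
Qed.

Lemma bounded_mfun_integrable f : bounded_mfun f -> P.-integrable setT (EFin \o f).
Proof.
move=> [mf [C fC]]; apply: measurable_bounded_integrable => //.
  exact: le_lt_trans (probability_le1 P measurableT) (ltry 1).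
exists C; split; first exact: num_real.
by move=> M CM w _; apply: le_trans (fC w) (ltW CM).
Qed.

Lemma Rintegral_bounded_sum (J : Type) (s : seq J) (F : J -> T -> R) :
  (forall j, bounded_mfun (F j)) ->
  \int[P]_w (\sum_(j <- s) F j w) = \sum_(j <- s) \int[P]_w F j w.
Proof.
move=> bF; elim: s => [|j s IH].
  rewrite big_nil; under eq_Rintegral do rewrite big_nil.
  by rewrite Rintegral_cst // mul0r.
under eq_Rintegral do rewrite big_cons.
rewrite RintegralD ?big_cons ?IH //; first exact: bounded_mfun_integrable.
exact/bounded_mfun_integrable/bounded_mfun_sum.
Qed.

End BoundedMeasurable.

Section SpinModel.
Context {R : realType} {dT : measure_display} {T : measurableType dT} (P : probability T R).
Context {n d : nat} {eps : T -> signfun R (Ups n d)} (heps : spin_model P eps).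
Local Notation Ups2 := (Ups n d * Ups n d)%type.
Local Notation sgn j := (fun w => eps w j.1 j.2).
Local Notation neg j := ((fun w => eps w j.1 j.2) @^-1` [set -1]).

Lemma measurable_neg (j : Ups2) : (j.1 < j.2)%O -> measurable (neg j).
Proof.
move=> lt; have := spin_model_measurable heps lt measurableT (measurable_set1 (-1 : R)).
by rewrite setTI.
Qed.

Lemma bounded_mfun_sgn (j : Ups2) : (j.1 < j.2)%O -> bounded_mfun (sgn j).
Proof.
move=> lt; split; first exact: (spin_model_measurable heps lt).
by exists 1 => w; case: (signfunP (eps w) j.1 j.2) => ->; rewrite ?normrN normr1.
Qed.

(** This turns products of signs into combinations of indicators of intersections, the events to
    which the independence hypothesis applies. *)
Lemma sgn_indic (j : Ups2) w : eps w j.1 j.2 = 1 - 2 * \1_(neg j) w.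
Proof.
rewrite indicE; case: (signfunP (eps w) j.1 j.2) => E.
  rewrite memNset ?mulr0 ?subr0 //= E => /eqP.
  by rewrite -subr_eq0 opprK (_ : 1 + 1 = 2%:R) // pnatr_eq0.
by rewrite mem_set //= E mulr1; ring.
Qed.

Definition all_neg (G : seq Ups2) : set T := \big[setI/setT]_(j <- G) neg j.

Lemma measurable_all_neg (G : seq Ups2) : {in G, forall j, (j.1 < j.2)%O} ->
  measurable (all_neg G).
Proof.
rewrite /all_neg; elim: G => [|j G IH] lG; first by rewrite big_nil; exact: measurableT.
rewrite big_cons; apply: measurableI; first exact/measurable_neg/lG/mem_head.
by apply: IH => k kG; apply: lG; rewrite inE kG orbT.
Qed.

Lemma prob_all_neg (G : seq Ups2) (j : Ups2) : {in j :: G, forall j, (j.1 < j.2)%O} ->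
  j \notin G -> P (neg j `&` all_neg G) = (P (neg j) * P (all_neg G))%E.
Proof.
move=> lG jG.
have allE : all_neg G = \big[setI/setT]_(k <- undup G) neg k.
  by rewrite /all_neg big_undup //; exact: setIid.
have ind F : uniq F -> {in F, forall k, (k.1 < k.2)%O} ->
    P (\big[setI/setT]_(k <- F) neg k) = (\prod_(k <- F) P (neg k))%E.
  have indep := spin_model_independent heps.
  by move=> uF lF; exact: (indep F (fun=> [set -1]) uF lF (fun=> measurable_set1 _)).
have := ind (j :: undup G); rewrite !big_cons -allE /= mem_undup jG undup_uniq.
rewrite allE ind ?undup_uniq //; last first.
  by move=> k; rewrite mem_undup => kG; apply: lG; rewrite inE kG orbT.
by apply=> // k; rewrite inE mem_undup -in_cons; exact: lG.
Qed.

(** Induction on [F] with [G] arbitrary: expanding the first sign by [sgn_indic] gives two integrals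
    of the same form, one with its event added to [G]. For empty [F], independence leaves P(G) - 2
    (1/2) P(G) = 0. *)
Lemma Rintegral_indic_sgn (G F : seq Ups2) (j : Ups2) :
  P (neg j) = (2^-1)%:E -> {in j :: G ++ F, forall j, (j.1 < j.2)%O} ->
  j \notin G ++ F ->
  \int[P]_w (\1_(all_neg G) w * (eps w j.1 j.2 * \prod_(k <- F) eps w k.1 k.2)) = 0.
Proof.
move=> Pj; elim: F G => [|k F IH] G lG jG.
  rewrite cats0 in lG jG.
  have mG : measurable (all_neg G).
    by apply: measurable_all_neg => k kG; apply: lG; rewrite inE kG orbT.
  have mj : measurable (neg j) by apply/measurable_neg/lG/mem_head.
  transitivity (\int[P]_w (\1_(all_neg G) w + (- 2) * \1_(neg j `&` all_neg G) w)).
    apply: eq_Rintegral => w _.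
    by rewrite big_nil mulr1 sgn_indic indicI /= mulrBr mulr1; congr (_ + _); ring.
  rewrite RintegralD //; last 2 first.
  - exact/bounded_mfun_integrable/bounded_mfun_indic.
  - apply/bounded_mfun_integrable/bounded_mfunM; first exact: bounded_mfun_cst.
    exact/bounded_mfun_indic/measurableI.
  rewrite RintegralZl //; last first.
    exact/bounded_mfun_integrable/bounded_mfun_indic/measurableI.
  have mI := measurableI _ _ mj mG.
  rewrite /Rintegral !integral_indic // !setIT -[X in -2 * fine X]/(P (neg j `&` all_neg G)).
  rewrite prob_all_neg // Pj.
  have fG : P (all_neg G) \is a fin_num by exact: fin_num_measure.
  by rewrite -(fineK fG) /=; set x := fine _; field.
have lk : (k.1 < k.2)%O by apply: lG; rewrite inE mem_cat mem_head !orbT.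
have jk : {in j :: (k :: G) ++ F, forall j, (j.1 < j.2)%O}.
  move=> l; rewrite in_cons mem_cat in_cons => lin; apply: lG.
  rewrite in_cons mem_cat in_cons.
  by case/orP: lin => [->//|]; rewrite -orbA => /or3P[] ->; rewrite ?orbT.
have jG' : {in j :: G ++ F, forall j, (j.1 < j.2)%O}.
  move=> l; rewrite in_cons mem_cat => lin; apply: lG.
  rewrite in_cons mem_cat in_cons; case/or3P: lin => ->; rewrite ?orbT //.
have jnk : j \notin (k :: G) ++ F.
  by move: jG; rewrite !(inE, mem_cat) !negb_or => /and3P[-> -> ->].
have jnG : j \notin G ++ F.
  by move: jG; rewrite !(inE, mem_cat) !negb_or => /and3P[-> _ ->].
transitivity (\int[P]_w (
  \1_(all_neg G) w * (eps w j.1 j.2 * \prod_(k <- F) eps w k.1 k.2) + (- 2) *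
  (\1_(all_neg (k :: G)) w * (eps w j.1 j.2 * \prod_(k <- F) eps w k.1 k.2)))).
  apply: eq_Rintegral => w _; rewrite big_cons (sgn_indic k) /all_neg big_cons indicI /=.
  by set a := \1_ _ w; set b := \1_ _ w; set p := \prod_(_ <- _) _; ring.
have b H : {in j :: H ++ F, forall j, (j.1 < j.2)%O} -> bounded_mfun (fun w =>
    \1_(all_neg H) w * (eps w j.1 j.2 * \prod_(k <- F) eps w k.1 k.2)).
  move=> lH; apply: bounded_mfunM.
    apply/bounded_mfun_indic/measurable_all_neg => l lin.
    by apply: lH; rewrite inE mem_cat lin orbT.
  apply: bounded_mfunM; first exact/bounded_mfun_sgn/lH/mem_head.
  apply: bounded_mfun_prod => l lin; apply: bounded_mfun_sgn.
  by apply: lH; rewrite inE mem_cat lin !orbT.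
rewrite RintegralD //; last 2 first.
- exact/bounded_mfun_integrable/b.
- by apply/bounded_mfun_integrable/bounded_mfunM; [exact: bounded_mfun_cst|exact: b].
rewrite RintegralZl //; last exact/bounded_mfun_integrable/b.
by rewrite !IH // mulr0 addr0.
Qed.

(** An odd power of a sign is the sign itself, so [j] can be taken to occur exactly once; the other
    signs may repeat. *)
Lemma Rintegral_odd_sgn (L : seq Ups2) (j : Ups2) :
  P (neg j) = (2^-1)%:E -> {in L, forall j, (j.1 < j.2)%O} -> odd (count_mem j L) ->
  \int[P]_w (\prod_(k <- L) eps w k.1 k.2) = 0.
Proof.
move=> Pj lL oj.
have jL : j \in L by rewrite -has_pred1 has_count; case: count oj.
rewrite -[RHS](@Rintegral_indic_sgn [::] [seq k <- L | k != j] j) //; last 2 first.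
- move=> k; rewrite inE mem_filter => /orP[/eqP ->|/andP[_]]; exact: lL.
- by rewrite mem_filter eqxx.
apply: eq_Rintegral => w _.
rewrite /all_neg big_nil indicT /= mul1r big_filter (bigID (pred1 j)) /=; congr (_ * _).
rewrite (eq_bigr (fun=> eps w j.1 j.2)) => [|k /eqP -> //].
rewrite big_const_seq iter_mulr_1 -(odd_double_half (count _ L)) oj -mul2n exprD exprM.
by case: (signfunP (eps w) j.1 j.2) => ->; rewrite ?sqrrN !expr1n mulr1.
Qed.

End SpinModel.

(** * Almost sure convergence from summable second moments *)

Lemma sum_inv_squares_le2 (R : realType) (N : nat) :
  \sum_(0 <= m < N.+1) (m.+1%:R : R) ^- 2 <= 2 - N.+1%:R^-1.
Proof.
elim: N => [|N IH].
  by rewrite big_nat1 expr1n invr1; lra.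
rewrite big_nat_recr //=; apply: (le_trans (lerD IH (lexx _))).
have a0 : 0 < N.+1%:R :> R by rewrite ltr0n.
have -> : N.+2%:R = N.+1%:R + 1 :> R by rewrite -[in LHS]addn1 natrD.
move: (N.+1%:R : R) a0 => a a0.
have a1 : 0 < a + 1 by lra.
rewrite -subr_ge0.
(* Telescoping: 1/(a+1)^2 is at most 1/a - 1/(a+1). *)
have -> : 2 - (a + 1)^-1 - (2 - a^-1 + (a + 1) ^- 2) = a^-1 * (a + 1) ^- 2.
  by field; rewrite !gt_eqF.
by rewrite mulr_ge0 // invr_ge0 ?exprn_ge0 // ltW.
Qed.

Section SecondMoments.
Context {R : realType} {dT : measure_display} {T : measurableType dT} (P : probability T R).

(** By monotone convergence the series of the squares has a finite integral, hence is finite almost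
    everywhere, and the terms of a convergent series tend to 0. *)
Lemma ae_cvg0_second_moments (X : nat -> T -> R) (K : R) :
  (forall m, bounded_mfun (X m)) ->
  (forall m, \int[P]_w (X m w ^+ 2) <= K * m.+1%:R ^- 2) ->
  {ae P, forall w, X m w @[m --> \oo] --> 0}.
Proof.
move=> bX XK.
have bX2 m : bounded_mfun (fun w => X m w ^+ 2).
  by under eq_fun do rewrite expr2; exact: bounded_mfunM.
pose f m w : \bar R := (X m w ^+ 2)%:E.
have f0 m w : (0 <= f m w)%E by rewrite lee_fin sqr_ge0.
have mf m : measurable_fun setT (f m) by apply/measurable_EFinP; have [] := bX2 m.
have K0 : 0 <= K.
  have := XK 0%N; rewrite expr1n invr1 mulr1; apply: le_trans.
  by apply: Rintegral_ge0 => w _; exact: sqr_ge0.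
have intf m : (\int[P]_w f m w = (\int[P]_w (X m w ^+ 2))%:E)%E.
  by rewrite /Rintegral fineK // integrable_fin_num //; exact: bounded_mfun_integrable.
have sumf : (\int[P]_w (\sum_(m <oo) f m w) <= (K * 2)%:E)%E.
  rewrite integral_nneseries //.
  apply: lime_le; first by apply: is_cvg_nneseries => m _ _; exact: integral_ge0.
  (* The empty partial sum is split off because [sum_inv_squares_le2] bounds sums with at least one
     term. *)
  apply: nearW => -[|N]; first by rewrite big_geq // lee_fin mulr_ge0.
  under eq_bigr do rewrite intf.
  rewrite sumEFin lee_fin; apply: (@le_trans _ _ (\sum_(0 <= m < N.+1) K * m.+1%:R ^- 2)).
    by apply: ler_sum.
  rewrite -mulr_sumr ler_wpM2l //; apply: le_trans (sum_inv_squares_le2 _ _) _.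
  by rewrite lerBlDr lerDl invr_ge0.
have int : P.-integrable setT (fun w => \sum_(m <oo) f m w)%E.
  apply/integrableP; split.
    exact: (@ge0_emeasurable_sum _ _ _ setT f xpredT).
  under eq_integral do rewrite gee0_abs ?nneseries_ge0 //.
  exact: le_lt_trans sumf (ltry _).
have := integrable_ae measurableT int; apply: filterS => w /(_ I) finw.
have cs : cvgn (series (fun m => X m w ^+ 2)).
  apply: nondecreasing_is_cvgn.
    by apply/nondecreasing_seqP => k; rewrite /series /= big_nat_recr //= lerDl sqr_ge0.
  exists (fine (\sum_(m <oo) f m w)%E) => _ [N _ <-].
  rewrite -lee_fin fineK // /series /= -sumEFin.
  exact: (@nneseries_lim_ge _ (fun m => f m w) xpredT 0).
have := cvg_series_cvg_0 cs => X0.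
have : Num.sqrt (X m w ^+ 2) @[m --> \oo] --> Num.sqrt (0 : R).
  exact: (continuous_cvg _ (@sqrt_continuous R 0) X0).
rewrite sqrtr0; under eq_fun do rewrite sqrtr_sqr.
by move/norm_cvg0P.
Qed.

End SecondMoments.

(** Such a pair is encoded by a table of [r] values and, for each of its 2s entries, a position in
    the table. *)
Lemma card_tuple_pairs (X : finType) (s r : nat) : (0 < s)%N ->
  (#|[set tu : s.-tuple X * s.-tuple X | (size (undup (tu.1 ++ tu.2)) <= r)%N]%SET|
   <= r ^ (s + s) * #|X| ^ r)%N.
Proof.
move=> s0; case: r => [|r].
  rewrite exp0n ?addn_gt0 ?s0 // mul0n leqn0 cards_eq0; apply/eqP/finset.setP => -[t u].
  rewrite !inE /= leqn0 size_eq0; apply/eqP => E.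
  have /eqP := congr1 size (undup_nil E); rewrite size_cat size_tuple addn_eq0 gtn_eqF //.
pose f (h : (s.-tuple 'I_r.+1 * s.-tuple 'I_r.+1) * r.+1.-tuple X) :=
  (map_tuple (tnth h.2) h.1.1, map_tuple (tnth h.2) h.1.2).
have -> : (r.+1 ^ (s + s) * #|X| ^ r.+1 =
    #|{: (s.-tuple 'I_r.+1 * s.-tuple 'I_r.+1) * r.+1.-tuple X}|)%N.
  by rewrite !card_prod !card_tuple card_ord expnD.
apply: leq_trans (leq_imset_card f _).
apply: subset_leq_card; apply/fintype.subsetP => -[t u]; rewrite inE /= => sD.
set D := undup (t ++ u) in sD.
have x0 : X := tnth t (Ordinal s0).
(* The table lists the distinct entries and is padded by the arbitrary entry [x0]. *)
pose g := [tuple nth x0 D i | i < r.+1].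
pose h (v : s.-tuple X) := map_tuple (fun x => inord (index x D) : 'I_r.+1) v.
apply/imsetP; exists ((h t, h u), g) => //; rewrite /f /=.
have hK (v : s.-tuple X) : {subset v <= D} -> map_tuple (tnth g) (h v) = v.
  move=> vD; apply: val_inj; rewrite /= -map_comp map_id_in // => x /vD xD /=.
  rewrite tnth_mktuple inordK ?nth_index //.
  by apply: leq_trans sD; rewrite index_mem.
by rewrite !hK // => x; rewrite mem_undup mem_cat => ->; rewrite ?orbT.
Qed.

(** * Second moments of color-reduced words *)

Section UpsWords.
Context {n d : nat}.
Implicit Type w : seq ('I_n * 'I_d).

Lemma map_fst_Ups_word m w (t : (size w).-tuple 'I_m) :
  map (fun p : Ups n d => p.1) (Ups_word w t) = w.
Proof.
rewrite /Ups_word -map_comp -[RHS](@unzip1_zip _ _ w t) ?size_tuple //.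
by apply: eq_map => -[[a i] k].
Qed.

Lemma size_Ups_word m w (t : (size w).-tuple 'I_m) : size (Ups_word w t) = size w.
Proof. by have := congr1 size (map_fst_Ups_word t); rewrite size_map. Qed.

Lemma color_reduced_Ups_word m w (t : (size w).-tuple 'I_m) :
  color_reduced (@fst _ _) w ->
  color_reduced (fun p : Ups n d => p.1.1) (Ups_word w t).
Proof.
move=> cr; apply: (@color_reduced_map _ _ _ (@fst _ _) (fun p : Ups n d => p.1)).
by rewrite map_fst_Ups_word.
Qed.

(** Projecting letters to their third index can only identify some of them. *)
Lemma size_undup_Ups_word m w (t u : (size w).-tuple 'I_m) :
  (size (undup (t ++ u)) <= size (undup (Ups_word w t ++ Ups_word w u)))%N.
Proof.
rewrite /Ups_word -map_cat (undup_map_inj (@Ups_incl_inj n d m)) size_map.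
have -> : t ++ u = map snd (zip w t ++ zip w u).
  by rewrite map_cat -!/(unzip2 _) !unzip2_zip ?size_tuple.
set v := zip w t ++ _.
rewrite -(size_map snd (undup v)); apply: uniq_leq_size; first exact: undup_uniq.
by move=> x; rewrite mem_undup => /mapP[p pv ->]; apply: map_f; rewrite mem_undup.
Qed.

End UpsWords.

Section MomentBounds.
Context {R : realType} {dT : measure_display} {T : measurableType dT} (P : probability T R).
Context {n d : nat} {eps : T -> signfun R (Ups n d)} (heps : spin_model P eps).
Implicit Type w : seq ('I_n * 'I_d).

Lemma bounded_mfun_word_sign (v : seq (Ups n d)) :
  bounded_mfun (fun om => word_sign (eps om) v).
Proof.
apply: bounded_mfun_prod => pq /ordered_pairs_lt lt; exact: (bounded_mfun_sgn heps lt).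
Qed.

Lemma bounded_mfun_spin_moment m w : bounded_mfun (fun om => spin_moment (eps om) m w).
Proof.
apply: bounded_mfunM; first exact: bounded_mfun_cst.
apply: bounded_mfun_sum => t.
under eq_fun do rewrite -mulr_natr.
by apply: bounded_mfunM; [exact: bounded_mfun_word_sign|exact: bounded_mfun_cst].
Qed.

Lemma prod_sign_le1 (e : signfun R (Ups n d)) (s : seq (Ups n d * Ups n d)) :
  \prod_(pq <- s) e pq.1 pq.2 <= 1.
Proof.
apply: le_trans (ler_norm _) _; rewrite normr_prod.
by apply: prodr_ile1 => pq _; case: (signfunP e pq.1 pq.2) => ->;
  rewrite ?normrN normr1 lexx ler01.
Qed.

(** With few distinct letters the trivial bound 1 is enough; otherwise a sign between different
    colors, a fair one, occurs to an odd power and the integral vanishes. The bound involves only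
    the indices, ready for [card_tuple_pairs]. *)
Lemma Rintegral_word_signM w m (t u : (size w).-tuple 'I_m) :
  color_reduced (@fst _ _) w -> (0 < size w)%N ->
  \int[P]_om ((word_sign (eps om) (Ups_word w t) *+ even_word (Ups_word w t)) *
              (word_sign (eps om) (Ups_word w u) *+ even_word (Ups_word w u)))
  <= (size (undup (t ++ u)) + 2 <= size w)%N%:R.
Proof.
move=> cr w0; set W := Ups_word w t; set V := Ups_word w u.
have [ew|_] := boolP (even_word W); last first.
  under eq_Rintegral do rewrite mulr0n mul0r.
  by rewrite Rintegral_cst // mul0r ler0n.
have [ev|_] := boolP (even_word V); last first.
  under eq_Rintegral do rewrite mulr0n mulr0.
  by rewrite Rintegral_cst // mul0r ler0n.
have E om : word_sign (eps om) W *+ true * (word_sign (eps om) V *+ true) =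
    \prod_(pq <- ordered_pairs W ++ ordered_pairs V) eps om pq.1 pq.2.
  by rewrite !mulr1n big_cat.
under eq_Rintegral do rewrite E.
have lt : {in ordered_pairs W ++ ordered_pairs V, forall j, (j.1 < j.2)%O}.
  by move=> pq; rewrite mem_cat => /orP[] /ordered_pairs_lt.
have [few|many] := leqP (size (undup (W ++ V)) + 2) (size w).
  have -> : (size (undup (t ++ u)) + 2 <= size w)%N.
    by apply: leq_trans few; rewrite leq_add2r size_undup_Ups_word.
  rewrite -[leRHS](_ : \int[P]_om 1 = 1); last first.
    by rewrite Rintegral_cst // mul1r -[X in fine X]/(P setT) probability_setT.
  apply: le_Rintegral => //.
  - apply/bounded_mfun_integrable/bounded_mfun_prod => pq /lt lpq.
    exact: (bounded_mfun_sgn heps lpq).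
  - exact/bounded_mfun_integrable/bounded_mfun_cst.
  - by move=> om _; exact: prod_sign_le1.
have [|||p [q [pq cpq oj]]] := odd_pair_exists (color_reduced_Ups_word (t := t) cr)
    (color_reduced_Ups_word (t := u) cr) ew ev; rewrite ?size_Ups_word //.
rewrite (Rintegral_odd_sgn heps (j := (p, q))) // ?ler0n //.
by have := spin_model_law heps pq; rewrite (negPf cpq).
Qed.

(** With s = [size w], the normalization (m+1)^(-s) meets at most a constant times (m+1)^(s-2)
    contributing pairs of tuples. *)
Lemma second_spin_moment_le w m : color_reduced (@fst _ _) w -> (0 < size w)%N ->
  \int[P]_om (spin_moment (eps om) m.+1 w ^+ 2) <=
  ((size w - 2) ^ (size w + size w))%:R * m.+1%:R ^- 2.
Proof.
move=> cr w0; set s := size w; set M := m.+1%:R : R.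
have M0 : 0 < M by rewrite ltr0n.
pose Z om (t : s.-tuple 'I_m.+1) : R :=
  word_sign (eps om) (Ups_word w t) *+ even_word (Ups_word w t).
have E om : spin_moment (eps om) m.+1 w ^+ 2 =
    M ^- s * \sum_(tu : s.-tuple 'I_m.+1 * s.-tuple 'I_m.+1) Z om tu.1 * Z om tu.2.
  rewrite /spin_moment expr2 mulrACA -exprMn -invfM -expr2 sqr_sqrtr ?ltW // exprVn.
  congr (_ * _); rewrite -(pair_bigA _ (fun t u => Z om t * Z om u)) /= mulr_suml.
  by apply: eq_bigr => t _; rewrite mulr_sumr.
under eq_Rintegral do rewrite E.
have bZ t : bounded_mfun (fun om => Z om t).
  under eq_fun do rewrite /Z -mulr_natr.
  by apply: bounded_mfunM; [exact: bounded_mfun_word_sign|exact: bounded_mfun_cst].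
have bZZ tu : bounded_mfun (fun om => Z om tu.1 * Z om tu.2) by exact: bounded_mfunM.
rewrite RintegralZl //; last exact/bounded_mfun_integrable/bounded_mfun_sum.
rewrite Rintegral_bounded_sum //.
apply: (@le_trans _ _ (M ^- s * \sum_(tu : s.-tuple 'I_m.+1 * s.-tuple 'I_m.+1)
    (size (undup (tu.1 ++ tu.2)) + 2 <= s)%N%:R)).
  apply: ler_wpM2l; first by rewrite invr_ge0 exprn_ge0 // ltW.
  by apply: ler_sum => tu _; exact: Rintegral_word_signM.
(* For s = 1 the subtraction [s - 2] is truncated, but then no pair contributes. *)
have [s2|s2] := leqP 2 s; last first.
  rewrite big1 ?mulr0 => [|tu _].
    by rewrite mulr_ge0 ?ler0n // invr_ge0 exprn_ge0 // ltW.
  by rewrite leqNgt (leq_trans s2) // leq_addl.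
rewrite mulrC ler_pdivrMr ?exprn_gt0 //.
have -> : ((s - 2) ^ (s + s))%:R * M ^- 2 * M ^+ s = ((s - 2) ^ (s + s) * m.+1 ^ (s - 2))%:R.
  rewrite natrM (natrX _ m.+1) -mulrA; congr (_ * _).
  by rewrite -{1}(subnK s2) exprD mulrCA mulVf ?mulr1 // expf_neq0 // gt_eqF.
rewrite -natr_sum ler_nat; apply: leq_trans (_ : _ <= _)%N; last first.
  have := @card_tuple_pairs 'I_m.+1 s (s - 2) w0; rewrite card_ord; apply.
rewrite -sum1_card [leqRHS]big_mkcond /=; apply: leq_sum => tu _.
by rewrite inE leq_subRL // addnC; case: leqP.
Qed.

Lemma spin_moment_cvg0 w : color_reduced (@fst _ _) w -> (0 < size w)%N ->
  {ae P, forall om, spin_moment (eps om) m w @[m --> \oo] --> 0}.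
Proof.
move=> cr w0.
have := @ae_cvg0_second_moments _ _ _ P (fun m om => spin_moment (eps om) m.+1 w) _
  (fun m => bounded_mfun_spin_moment m.+1 w) (fun m => second_spin_moment_le m cr w0).
by apply: filterS => om; rewrite (cvg_shiftS (fun m => spin_moment (eps om) m w)).
Qed.

End MomentBounds.

(** * Words in the free product *)

Section AnticommutingWords.
Context {A : nzRingType} {L : eqType} {B : eqType} (c : L -> B) (X : L -> A).
Context (XX : forall l, X l * X l = 1).
Context (XC : forall l l', c l = c l' -> l != l' -> X l * X l' = - (X l' * X l)).

Lemma anticommuting_cross x w : all (fun y => c y == c x) w ->
  X x * \prod_(l <- w) X l =
  (-1) ^+ count (predC1 x) w * (\prod_(l <- w) X l * X x).
Proof.
elim: w => [|y w IH] /=; first by rewrite !big_nil !mul1r mulr1.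
move=> /andP[/eqP cy /IH {}IH]; rewrite !big_cons mulrA.
have [->|yx] /= := eqVneq y x.
  by rewrite -mulrA [in LHS]IH add0n mulrA (commr_sign (X x)) -!mulrA.
rewrite (XC (esym cy)); last by rewrite eq_sym.
by rewrite mulNr -[in LHS]mulrA IH mulrA (commr_sign (X y)) add1n exprS -!mulrA mulN1r.
Qed.

(** The first [x] moves through [w2], changing sign at each letter other than [x], and meets the
    second one, where the square is 1. The ring is arbitrary so that both [xtilde] and [fp_gen] are
    covered. *)
Lemma anticommuting_cancel w1 x w2 w3 : all (fun y => c y == c x) w2 ->
  \prod_(l <- w1 ++ x :: w2 ++ x :: w3) X l =
  (-1) ^+ count (predC1 x) w2 * \prod_(l <- w1 ++ w2 ++ w3) X l.
Proof.
move=> /anticommuting_cross E.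
rewrite !big_cat big_cons big_cat big_cons /= (mulrA (X x)) E -!mulrA (mulrA (X x) (X x)) XX mul1r.
by rewrite mulrA commr_sign -!mulrA.
Qed.

End AnticommutingWords.

Lemma spin_adj_prod (R : realType) (disp : Order.disp_t) (I : finOrderType disp)
    (e : signfun R I) (s : seq I) :
  spin_adj (\prod_(p <- s) spin_gen e p) = \prod_(p <- rev s) spin_gen e p.
Proof.
elim: s => [|p s IH]; first by rewrite !big_nil spin_adj1.
by rewrite big_cons spin_adjM IH spin_gen_adj rev_cons -cats1 big_cat big_seq1.
Qed.

Section FreeWords.
Context {R : realType} {n d : nat}.
Implicit Types (w : seq ('I_n * 'I_d)) (v : fp_word n d).
Local Notation cliff := (spin_alg (clifford_sign R 'I_d)).

(** After the generator [l] acts on a vector, the coefficient at [v] depends only on the old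
    coefficient at this word. *)
Definition fp_toggle v (l : 'I_n * 'I_d) : fp_word n d :=
  fp_put l.1 [set j | (j == l.2) (+) (j \in fp_head l.1 v)]%SET v.

(** The coefficient is the trace of the word made of [A] reversed, then [i], then [B], which
    vanishes unless all multiplicities are even. *)
Lemma cliff_coef_gen i (A B : {set 'I_d}) :
  B != [set j | (j == i) (+) (j \in A)]%SET ->
  cliff_coef (spin_gen _ i : cliff) A B = 0.
Proof.
rewrite /cliff_coef /spin_mon spin_adj_prod -big_rcons -big_cat spin_tau_word => BA.
case: even_wordP => // ew; case/eqP: BA; apply/finset.setP => j; rewrite inE.
have := ew j; rewrite cat_rcons count_cat count_rev /= !count_uniq_mem ?sort_uniq ?enum_uniq //.
rewrite !mem_sort !mem_enum !oddD !oddb (eq_sym i).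
by case: (j \in A); case: (j == i); case: (j \in B).
Qed.

(** The coefficient at [v] is traced back letter by letter, leftmost first, to a coefficient of the
    vacuum vector, whose support is the empty word. *)
Lemma fp_gen_word_support w v :
  (\prod_(l <- w) fp_gen l.1 l.2 : @fp_alg R n d) (ell2_delta (fp_nil n d)) v != 0 ->
  foldl fp_toggle v w = fp_nil n d.
Proof.
elim: w v => [|l w IH] v /=.
  rewrite big_nil -[X in X != 0]/((v == fp_nil n d)%:R : R[i]).
  by apply: contraNeq => /negPf ->.
rewrite big_cons; set F := \prod_(l <- w) _.
rewrite -[X in X != 0]/(fp_lact_fun l.1 (spin_gen _ l.2) (F (ell2_delta (fp_nil n d))) v).
rewrite /fp_lact_fun (bigD1 [set j | (j == l.2) (+) (j \in fp_head l.1 v)]%SET) //=.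
rewrite [X in _ + X]big1 ?addr0 => [|B BA]; last by rewrite cliff_coef_gen // mul0r.
by rewrite mulf_eq0 negb_or => /andP[_]; exact: IH.
Qed.

(* The head of the word reached so far records the letters of the current run. *)
Lemma foldl_fp_toggle_reduced w : color_reduced (@fst _ _) w -> w != [::] ->
  exists al (A : {set 'I_d}) y,
    foldl fp_toggle (fp_nil n d) w = (al, A) :: y :> seq _ /\
    forall j, j \in A -> exists w1 w2,
      w = w1 ++ (al, j) :: w2 /\ all (fun l => l.1 == al) w2.
Proof.
elim/last_ind: w => // w [be k] IH cr _; rewrite foldl_rcons.
have [->|w0] := eqVneq w [::].
  exists be, [set k]%SET, [::]; split=> /=.
    have -> : [set j | (j == k) (+) (j \in fp_head be (fp_nil n d))]%SET = [set k]%SET.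
      by apply/finset.setP => j; rewrite !inE addbF.
    by rewrite -cards_eq0 cards1.
  by move=> j; rewrite inE => /eqP ->; exists [::], [::].
have [|al [A [y [E AE]]]] := IH _ w0.
  move=> w1 x w2 w3 wE; apply: (cr w1 x w2 (rcons w3 (be, k))).
  by rewrite wE !rcons_cat /= !rcons_cat.
move: E; case: (foldl _ _ _) => u uR /= uE.
rewrite uE /=; have [bal|abe] := eqVneq al be; last first.
  have -> : [set j | (j == k) (+) (j \in finset.set0)]%SET = [set k]%SET.
    by apply/finset.setP => j; rewrite !inE addbF.
  exists be, [set k]%SET, ((al, A) :: y); split; first by rewrite -cards_eq0 cards1.
  by move=> j; rewrite inE => /eqP ->; exists w, [::]; rewrite cats1.
(* An earlier [k] in the current run would be separated from the new one only by letters of the same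
   color, against reducedness. So toggling enlarges the head and never empties it. *)
have kA : k \notin A.
  apply/negP => /AE[w1 [w2 [wE w2a]]].
  have /hasP[z zw2] : has (fun l => l.1 != al) w2.
    by apply: (cr w1 (al, k) w2 [::]); rewrite wE bal -!cats1 -catA.
  by move/allP: w2a => /(_ _ zw2) ->.
set A' := [set _ | _]%SET.
have kA' : k \in A' by rewrite inE eqxx (negPf kA).
have -> : (A' == finset.set0) = false by apply/negbTE/finset.set0Pn; exists k.
exists be, A', y; split=> // j; rewrite inE.
have [-> _|jk /= /AE[w1 [w2 [wE w2a]]]] := eqVneq j k.
  by exists w, [::]; rewrite cats1.
exists w1, (rcons w2 (be, k)); rewrite wE bal all_rcons /= eqxx -bal w2a; split=> //.
by rewrite rcons_cat.
Qed.

(** A nonzero vacuum coefficient would require the toggles to lead from the empty word back to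
    itself. *)
Lemma fp_tau_reduced w : color_reduced (@fst _ _) w -> w != [::] ->
  fp_tau (\prod_(l <- w) fp_gen l.1 l.2 : @fp_alg R n d) = 0.
Proof.
move=> cr w0; apply/eqP; apply: contraT => /fp_gen_word_support E.
by have [al [A [y []]]] := foldl_fp_toggle_reduced cr w0; rewrite E.
Qed.

Lemma fp_embZ (al : 'I_n) (x : R[i]) (a : cliff) :
  fp_emb al (x *: a) = x *: fp_emb al a.
Proof.
apply/val_inj/funext => f; apply/val_inj/funext => v.
rewrite -[LHS]/(fp_lact_fun al (x *: a) f v) -[RHS]/(x * fp_lact_fun al a f v).
rewrite /fp_lact_fun mulr_sumr; apply: eq_bigr => B _.
have -> : cliff_coef (x *: a) (fp_head al v) B = x * cliff_coef a (fp_head al v) B.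
  by rewrite /cliff_coef -scalerAr -scalerAl linearZ.
by rewrite mulrA.
Qed.

Lemma fp_gen_sqr (al : 'I_n) i : fp_gen al i * fp_gen al i = 1 :> @fp_alg R n d.
Proof. by rewrite /fp_gen -fp_embM spin_gen_sqr fp_emb1. Qed.

Lemma fp_gen_anticomm (al : 'I_n) i j : i != j ->
  fp_gen al i * fp_gen al j = - (fp_gen al j * fp_gen al i) :> @fp_alg R n d.
Proof.
by move=> ij; rewrite /fp_gen -!fp_embM spin_gen_swap // fp_embZ rmorphN1 scaleN1r.
Qed.

Lemma fp_tau_sign k (F : @fp_alg R n d) : fp_tau ((-1) ^+ k * F) = (-1) ^+ k * fp_tau F.
Proof.
by rewrite -[in LHS]signr_odd -[in RHS]signr_odd !mulr_sign; case: ifP.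
Qed.

Lemma fp_tau1 : fp_tau (1 : @fp_alg R n d) = 1.
Proof. by rewrite -[LHS]/((fp_nil n d == fp_nil n d)%:R : R[i]) eqxx. Qed.

Lemma fp_tau_cancel w1 x w2 w3 : all (fun y => y.1 == x.1) w2 ->
  fp_tau (\prod_(l <- w1 ++ x :: w2 ++ x :: w3) fp_gen l.1 l.2 : @fp_alg R n d) =
  (-1) ^+ count (predC1 x) w2 *
    fp_tau (\prod_(l <- w1 ++ w2 ++ w3) fp_gen l.1 l.2 : @fp_alg R n d).
Proof.
move=> w2x; rewrite -fp_tau_sign; congr (fp_tau _).
apply: (anticommuting_cancel (c := @fst _ _)) => // [l|[al i] [be j] /= <- ij].
  exact: fp_gen_sqr.
by apply: fp_gen_anticomm; apply: contraNneq ij => ->.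
Qed.

End FreeWords.

(** * Convergence *)

Section Limits.
Context {R : realType} {n d : nat}.
Implicit Types (w : seq ('I_n * 'I_d)).

Lemma xtilde_sqr (e : signfun R (Ups n d)) m (al : 'I_n) (i : 'I_d) :
  (forall p q : Ups n d, p.1.1 = q.1.1 -> e p q = -1) -> (0 < m)%N ->
  xtilde e m al i * xtilde e m al i = 1.
Proof.
move=> eN m0; have := xtilde_anticomm al i i eN m0.
rewrite eqxx mulr1 -mulr2n -scaler_nat => /(congr1 (fun u => 2^-1 *: u)).
by rewrite !scalerA mulVf ?pnatr_eq0 // !scale1r.
Qed.

Lemma xtilde_swap (e : signfun R (Ups n d)) m (al : 'I_n) (i j : 'I_d) :
  (forall p q : Ups n d, p.1.1 = q.1.1 -> e p q = -1) -> (0 < m)%N -> i != j ->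
  xtilde e m al i * xtilde e m al j = - (xtilde e m al j * xtilde e m al i).
Proof.
move=> eN m0 /negPf ij; have := xtilde_anticomm al i j eN m0.
by rewrite ij mulr0 scale0r => /eqP; rewrite addr_eq0 => /eqP.
Qed.

Lemma real_complex_cvg0 (u : nat -> R) : u m @[m --> \oo] --> 0 ->
  ((fun m => (u m)%:C : R[i]^o) @ \oo --> (0 : R[i]^o)).
Proof.
move=> /cvgr0Pnorm_lt u0; apply/cvgr0Pnorm_lt => eps eps0.
(* A positive element of [R[i]] is real, so its real part serves as the real threshold. *)
have /u0 : 0 < complex.Re eps by move: eps0; rewrite ltcE /= => /andP[].
apply: filterS => m um.
have -> : eps = (complex.Re eps)%:C by apply/esym/RRe_real/gtr0_real.
by rewrite normc_def /= expr0n addr0 sqrtr_sqr ltcR.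
Qed.

Lemma spin_tau_xtilde_cancel (e : signfun R (Ups n d)) m w1 x w2 w3 :
  (forall p q : Ups n d, p.1.1 = q.1.1 -> e p q = -1) -> (0 < m)%N ->
  all (fun y => y.1 == x.1) w2 ->
  spin_tau (\prod_(l <- w1 ++ x :: w2 ++ x :: w3) xtilde e m l.1 l.2) =
  (-1) ^+ count (predC1 x) w2 *
    spin_tau (\prod_(l <- w1 ++ w2 ++ w3) xtilde e m l.1 l.2).
Proof.
move=> eN m0 w2x; rewrite -raddfMsign; congr (spin_tau _).
apply: (anticommuting_cancel (c := @fst _ _)) => // [l|[al i] [be j] /= <- ij].
  exact: xtilde_sqr.
by apply: xtilde_swap => //; apply: contraNneq ij => ->.
Qed.

Lemma cvg_sign_mul k (u : nat -> R[i]^o) (l : R[i]^o) :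
  u @ \oo --> l -> (fun m => (-1) ^+ k * u m : R[i]^o) @ \oo --> ((-1) ^+ k * l : R[i]^o).
Proof.
move=> ul; rewrite -signr_odd mulr_sign; under eq_fun do rewrite mulr_sign.
case: (odd k); last exact: ul.
exact: (@cvgN R[i] R[i]^o _ _ _ u l ul).
Qed.

Lemma spin_tau_cvg_cancel (e : signfun R (Ups n d)) w1 x w2 w3 :
  (forall p q : Ups n d, p.1.1 = q.1.1 -> e p q = -1) ->
  all (fun y => y.1 == x.1) w2 ->
  (fun m => spin_tau (\prod_(l <- w1 ++ w2 ++ w3) xtilde e m l.1 l.2) : R[i]^o) @ \oo
    --> (fp_tau (\prod_(l <- w1 ++ w2 ++ w3) fp_gen l.1 l.2) : R[i]^o) ->
  (fun m => spin_tau (\prod_(l <- w1 ++ x :: w2 ++ x :: w3) xtilde e m l.1 l.2) : R[i]^o) @ \oo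
    --> (fp_tau (\prod_(l <- w1 ++ x :: w2 ++ x :: w3) fp_gen l.1 l.2) : R[i]^o).
Proof.
move=> eN w2x /(@cvg_sign_mul (count (predC1 x) w2)); rewrite fp_tau_cancel //.
(* The cancellation identity is available for [0 < m], hence equality is claimed only for large
   m. *)
apply: cvg_trans; apply: near_eq_cvg; near=> m.
have m0 : (0 < m)%N by near: m; exact: nbhs_infty_gt.
by rewrite spin_tau_xtilde_cancel.
Unshelve. all: by end_near. Qed.

End Limits.

Section AlmostSure.
Context {R : realType} {dT : measure_display} {T : measurableType dT} (P : probability T R).
Context {n d : nat} {eps : T -> signfun R (Ups n d)} (heps : spin_model P eps).

Lemma ae_same_color_sign :
  {ae P, forall om, forall p q : Ups n d, p.1.1 = q.1.1 -> eps om p q = -1}.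
Proof.
have lt_ae (p q : Ups n d) : (p < q)%O -> p.1.1 = q.1.1 ->
    {ae P, forall om, eps om p q = -1}.
  move=> lt pq; exists (~` ((fun om => eps om p q) @^-1` [set -1])).
  have mN := measurable_neg heps (j := (p, q)) lt.
  split; [exact: measurableC | | by []].
  rewrite probability_setC // (spin_model_law heps lt) pq eqxx.
  by rewrite -EFinB subrr.
(* Enumerating the countably many index pairs by [unpickle] lets [ae_foralln] produce one null set
   for all of them. *)
have pair_ae k : {ae P, forall om,
    if unpickle k is Some pq then
      let p : Ups n d := pq.1 in let q : Ups n d := pq.2 in
      p.1.1 = q.1.1 -> eps om p q = -1 else True}.
  case: (unpickle k) => [[p q]|] /=; last exact: aeW.
  have [pq|pq] := eqVneq p.1.1 q.1.1; last first.
    by apply: aeW => om E; rewrite E eqxx in pq.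
  have [lt|lt|->] := ltgtP (p : Ups n d) q.
  - by apply: filterS (lt_ae _ _ lt pq).
  - by apply: filterS (lt_ae _ _ lt (esym pq)) => om E _; rewrite signfunC.
  - by apply: aeW => om _; exact: signfun_diag.
have := ae_foralln pair_ae; apply: filterS => om H p q.
by have := H (pickle (p : 'I_n * 'I_d * nat, q : 'I_n * 'I_d * nat)); rewrite pickleK.
Qed.

(** Induction on the length: a word that is not color-reduced loses two letters with the same sign
    on both sides; a nonempty reduced one has limit and free trace 0; the empty one gives 1. *)
Lemma ae_word_cvg (w : seq ('I_n * 'I_d)) : {ae P, forall om,
  (fun m => spin_tau (\prod_(l <- w) xtilde (eps om) m l.1 l.2) : R[i]^o) @ \oo
    --> (fp_tau (\prod_(l <- w) fp_gen l.1 l.2) : R[i]^o)}.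
Proof.
have [k] := ubnP (size w); elim: k w => // k IH w wk.
have [cr|/existsNP[w1 /existsNP[x /existsNP[w2 /existsNP[w3 /not_implyP[wE w2x]]]]]] :=
  pselect (color_reduced (@fst _ _) w).
  have [->|w0] := eqVneq w [::].
    apply: aeW => om; rewrite big_nil fp_tau1.
    under eq_fun do rewrite big_nil spin_tau1.
    exact: cvg_cst.
  have s0 : (0 < size w)%N by rewrite lt0n size_eq0.
  have := spin_moment_cvg0 heps cr s0; apply: filterS => om lim.
  rewrite fp_tau_reduced //; under eq_fun do rewrite spin_tau_xtilde.
  exact: real_complex_cvg0.
have w2a : all (fun y => y.1 == x.1) w2.
  by move/negP: w2x; rewrite -all_predC; apply: sub_all => y /= /negPn.
have wk' : (size (w1 ++ w2 ++ w3) < k)%N.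
  move: wk; rewrite wE !size_cat /= size_cat /= !addnS !ltnS; exact: ltnW.
rewrite wE.
by apply: filterS2 ae_same_color_sign (IH _ wk') => om eN; exact: spin_tau_cvg_cancel.
Qed.

End AlmostSure.

Theorem theorem2p3 (R : realType) (n d s : nat)
    (hn : (1 <= n)%N) (hd : (1 <= d)%N) (hs : (1 <= s)%N)
    (i : 'I_s -> 'I_d) (alpha : 'I_s -> 'I_n)
    (dT : measure_display) (T : measurableType dT) (P : probability T R)
    (eps : T -> signfun R (Ups n d)) (heps : spin_model P eps) :
  {ae P, forall w,
    (fun m : nat => spin_tau (\prod_(k < s) xtilde (eps w) m (alpha k) (i k)) : R[i]^o)
      @ \oo
      --> (fp_tau (\prod_(k < s) fp_gen (alpha k) (i k)) : R[i]^o)}.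
Proof.
have := ae_word_cvg heps [seq (alpha k, i k) | k <- index_enum 'I_s].
by apply: filterS => w; rewrite big_map; under eq_fun do rewrite big_map.
Qed.
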